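(* For every integer $d_*\ge 0$ there is a finite constant $K(d_* )$, depending only on $d_*$, such that the following holds. Let $G=(V,E)$ be a connected simple undirected graph (finite or infinite) with $\sup_{x\in V}\deg(x)=d_*$, and suppose that its unnormalised Laplacian satisfies $\mathrm{CD}(0,\infty)$, i.e. $\Gamma_2(f)(x)\ge 0$ for every $x\in V$ and every function $f:V\to\mathbb{R}$. Then $$\#B(x,2r)\le K(d_* )\,\#B(x,r)$$ for every $x\in V$ and every integer $r\ge 1$.
   Context: For a connected simple undirected graph $G=(V,E)$ of bounded degree, write $x\sim y$ if $\{x,y\}\in E$ and let $\operatorname{dist}$ be the graph distance. The unnormalised Laplacian is $\Delta f(x)=\sum_{y\sim x}(f(y)-f(x))$ for $f:V\to\mathbb{R}$. The carré du champ is $\Gamma(f,g)=\frac12(\Delta(fg)-f\Delta g-g\Delta f)$, and the iterated carré du champ is $\Gamma_2(f,g)=\frac12(\Delta\Gamma(f,g)-\Gamma(f,\Delta g)-\Gamma(g,\Delta f))$; write $\Gamma(f)=\Gamma(f,f)$ and $\Gamma_2(f)=\Gamma_2(f,f)$. Balls are open: $B(x,r)=\{y\in V:\operatorname{dist}(x,y)<r\}$. $\#A$ denotes the number of elements of $A$. *)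

(* Defs.v *)
From HB Require Import structures.
From mathcomp Require Import all_boot all_order all_algebra.
From mathcomp Require Import all_classical all_reals all_analysis.

Set Implicit Arguments.
Unset Strict Implicit.
Unset Printing Implicit Defensive.

Import Order.TTheory GRing.Theory Num.Theory.
Local Open Scope classical_set_scope.
Local Open Scope ring_scope.

(* The vertex set may be infinite. [choiceType] is no restriction: classically
   every type carries such a structure (and every relation is boolean). *)
Record sgraph := SGraph {
  vertex :> choiceType;
  adj : rel vertex;
  adj_sym : symmetric adj;
  adj_irr : irreflexive adj }.

Section Graph.
Variables (R : realType) (G : sgraph).
Implicit Types (x y : G) (f g : G -> R).

Definition walks x y : set (seq G) := [set p | path (@adj G) x p /\ last x p = y].

Definition connected_graph : Prop := forall x y, walks x y !=set0.

(* Extended-real valued, so that no junk value is needed when there is no walk: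
   the infimum of the empty set is +oo. The walk x :: p has size p edges. *)
Definition gdist x y : \bar R := ereal_inf [set (size p)%:R%:E | p in walks x y].

Definition gball x (r : nat) : set G := [set y | (gdist x y < r%:R%:E)%E].

Definition neighbors x : set G := [set y | adj x y].

(* [counting] is +oo on infinite sets. *)
Definition deg x : \bar R := counting (neighbors x).

(* [\sum_(y \in A)] is the intended sum when the neighbourhoods are finite,
   which holds as soon as all degrees are finite. *)
Definition laplacian f : G -> R := fun x => \sum_(y \in neighbors x) (f y - f x).

Definition Gamma f g : G -> R := fun x =>
  2^-1 * (laplacian (f \* g) x - f x * laplacian g x - g x * laplacian f x).

Definition Gamma2 f g : G -> R := fun x =>
  2^-1 * (laplacian (Gamma f g) x - Gamma f (laplacian g) x
          - Gamma g (laplacian f) x).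

Definition CD0oo : Prop := forall f x, 0 <= Gamma2 f f x.

End Graph.

Arguments connected_graph G : clear implicits.
Arguments gball R {G} x r.
Arguments deg R {G} x.
Arguments CD0oo R G : clear implicits.

(* Main.v *)
Require Import Defs.
From mathcomp Require Import all_boot all_order all_algebra.
From mathcomp Require Import all_classical all_reals all_analysis.
From mathcomp Require Import ring lra zify.

Set Implicit Arguments.
Unset Strict Implicit.
Unset Printing Implicit Defensive.

Import Order.TTheory GRing.Theory Num.Theory.
Local Open Scope classical_set_scope.
Local Open Scope ring_scope.

(** Write L for the Laplacian, and fix a bound D on the degrees.

    Curvature without a dimension bound would not suffice for doubling; here
    bounded degree supplies the dimension.  Testing the form Gamma2(f, .)
    against the indicator delta_x of a vertex gives two linear identities:
    4 Gamma2(f, delta_x)(x) = L L f(x) - 2 L f(x), whereas the sum over all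
    vertices w of Gamma2(f, delta_x)(w) equals L L f(x).  Eliminating L L f(x)
    and applying Cauchy-Schwarz to the nonnegative forms Gamma2(., .)(w) bounds
    (L f(x))^2 by a constant times the sum of Gamma2(f)(w) over the ball of
    radius 2 around x ([sqr_laplacian_le]).  So CD(0,n) holds for some n that
    depends on D only, up to averaging over balls of radius 2.

    As the chain rule fails on graphs, the logarithm of the heat semigroup is
    replaced, following Muench, by the flow u' = L u + Gamma(u).  Along it both
    -L u and Gamma(u) satisfy a maximum principle for the operator
    g |-> L g + 2 Gamma(u, g), which generates a Markov chain as long as the
    slopes of u are less than 1, and both dissipate 2 Gamma2(u).  From an
    initial datum with slopes at most e this yields
    -  -L u <= C e / sqrt t, where C depends on D only ([laplacian_decay]),
       by applying the maximum principle to -L u + lam Gamma(u) with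
       lam = 1 / (e sqrt t);
    -  t Gamma(u) <= sup u_0 - u ([flow_gradient]), since t Gamma(u) + u does
       not increase.

    Start from u_0 = - M min(1, dist(x, .) / r), so that e = M / r, and run the
    flow up to the time t = c r^2, where c depends on D only.  The first
    estimate bounds the height lost at x by C' M sqrt c, the second one bounds
    the slopes at time t by C' sqrt (M / c) / r.  If c is small, and then M
    large, u >= - M / 4 holds on B(x, 2r) ([flow_lower]).  On the other hand
    exp u satisfies the linear heat inequality up to terms that are cubic in
    the slopes; their total effect r^2 (M / r)^3 is small for r >> M^3.  So
    exp u <= e (P_t 1_B + exp (- M)) with B = B(x, r) ([exp_flow_le]), and
    therefore P_t 1_B >= exp (- M) on B(x, 2r).  Because P_t is symmetric and
    Markov, the sum of P_t 1_B over any set is at most #B, and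
    #B(x, 2r) <= exp M #B(x, r) follows ([doubling_at_scale]).  The remaining
    radii are bounded in terms of D, and the trivial growth bound applies.

    Time is discretized by explicit Euler steps whose length h is chosen after
    all other parameters.  The evolution identity for L u stays exact, and the
    one for Gamma(u) acquires an error of order h^2 per step, so that finite
    induction replaces the theory of evolution equations. *)

(** * Difference calculus on a graph of bounded degree *)

Definition nbrs (G : sgraph) (x : G) : seq G :=
  finmap.enum_fset (fset_set (neighbors x)).

(** The bound is taken positive, so that [D%:R] is at least 1 and absorbs
    constants. *)
Definition degree_bound (G : sgraph) (D : nat) : Prop :=
  (0 < D)%N /\
  forall x : G, finite_set (neighbors x) /\ (size (nbrs x) <= D)%N.

Section Calculus.
Variables (R : realType) (G : sgraph) (D : nat).
Hypothesis degD : degree_bound G D.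
Implicit Types (x y z w : G) (f g u : G -> R) (S : seq G).

Lemma degree_bound_ge1 : 1 <= D%:R :> R.
Proof. by case: degD => D0 _; rewrite ler1n. Qed.

Lemma mem_nbrs x y : (y \in nbrs x) = adj x y.
Proof.
case: degD => _ /(_ x)[fx _].
by rewrite /nbrs in_fset_set //; apply/idP/idP; rewrite inE.
Qed.

Lemma nbrs_uniq x : uniq (nbrs x).
Proof. exact: finmap.fset_uniq. Qed.

Lemma nbrs_sym x y : (y \in nbrs x) = (x \in nbrs y).
Proof. by rewrite !mem_nbrs adj_sym. Qed.

Lemma nbrs_irr x : (x \in nbrs x) = false.
Proof. by rewrite mem_nbrs adj_irr. Qed.

Lemma laplacianE f x : laplacian f x = \sum_(y <- nbrs x) (f y - f x).
Proof.
case: degD => _ /(_ x)[fx _].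
by rewrite /laplacian fsbig_finite.
Qed.

Lemma GammaE f g x :
  Gamma f g x = 2^-1 * \sum_(y <- nbrs x) (f y - f x) * (g y - g x).
Proof.
rewrite /Gamma !laplacianE !mulr_sumr -!sumrB mulr_sumr.
by apply: eq_bigr => y _ /=; ring.
Qed.

Lemma sum_nbrs_le (a : G -> R) (c : R) x : 0 <= c ->
  (forall y, y \in nbrs x -> a y <= c) -> \sum_(y <- nbrs x) a y <= D%:R * c.
Proof.
move=> c0 ac; apply: (@le_trans _ _ (\sum_(y <- nbrs x) c)).
  by rewrite big_seq [leRHS]big_seq; apply: ler_sum => y; exact: ac.
rewrite big_const_seq count_predT iter_addr_0 -[leLHS]mulr_natl.
by apply: ler_wpM2r => //; rewrite ler_nat; case: degD => _ /(_ x)[].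
Qed.

Lemma norm_sum_nbrs_le (a : G -> R) (c : R) x : 0 <= c ->
  (forall y, y \in nbrs x -> `|a y| <= c) ->
  `|\sum_(y <- nbrs x) a y| <= D%:R * c.
Proof.
move=> c0 ac; apply: le_trans (ler_norm_sum _ _ _) _.
exact: (sum_nbrs_le (a := fun y => `|a y|)).
Qed.

Lemma laplacianD f g x :
  laplacian (fun y => f y + g y) x = laplacian f x + laplacian g x.
Proof.
by rewrite !laplacianE -big_split /=; apply: eq_bigr => y _; ring.
Qed.

Lemma laplacianZ (c : R) f x : laplacian (fun y => c * f y) x = c * laplacian f x.
Proof. by rewrite !laplacianE mulr_sumr; apply: eq_bigr => y _; ring. Qed.

Lemma GammaC f g x : Gamma f g x = Gamma g f x.
Proof. by rewrite !GammaE; congr (_ * _); apply: eq_bigr => y _; ring. Qed.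

Lemma GammaDl f1 f2 g x :
  Gamma (fun y => f1 y + f2 y) g x = Gamma f1 g x + Gamma f2 g x.
Proof.
rewrite !GammaE -mulrDr; congr (_ * _); rewrite -big_split /=.
by apply: eq_bigr => y _; ring.
Qed.

Lemma GammaZl (c : R) f g x : Gamma (fun y => c * f y) g x = c * Gamma f g x.
Proof.
rewrite !GammaE mulrCA; congr (_ * _); rewrite mulr_sumr.
by apply: eq_bigr => y _; ring.
Qed.

Lemma GammaDr f g1 g2 x :
  Gamma f (fun y => g1 y + g2 y) x = Gamma f g1 x + Gamma f g2 x.
Proof. by rewrite GammaC GammaDl !(GammaC _ f). Qed.

Lemma GammaZr (c : R) f g x : Gamma f (fun y => c * g y) x = c * Gamma f g x.
Proof. by rewrite GammaC GammaZl (GammaC g). Qed.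

Lemma Gamma_ge0 f x : 0 <= Gamma f f x.
Proof.
rewrite GammaE mulr_ge0 ?invr_ge0 ?ler0n // sumr_ge0 // => y _.
by rewrite -expr2 sqr_ge0.
Qed.

Lemma sqr_slope_le_Gamma f x y : y \in nbrs x ->
  (f y - f x) ^+ 2 <= 2 * Gamma f f x.
Proof.
move=> yx; rewrite GammaE mulrA divff ?pnatr_eq0 // mul1r.
rewrite (bigD1_seq y) ?nbrs_uniq //= -expr2 lerDl sumr_ge0 // => z _.
by rewrite -expr2 sqr_ge0.
Qed.

Lemma Gamma_le_slope f g (a b : R) x : 0 <= a -> 0 <= b ->
  (forall y, y \in nbrs x -> `|f y - f x| <= a) ->
  (forall y, y \in nbrs x -> `|g y - g x| <= b) ->
  `|Gamma f g x| <= D%:R * (a * b).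
Proof.
move=> a0 b0 fa gb; rewrite GammaE normrM.
have h1 : `|\sum_(y <- nbrs x) (f y - f x) * (g y - g x)| <= D%:R * (a * b).
  apply: norm_sum_nbrs_le => [|y yx]; first exact: mulr_ge0.
  by rewrite normrM; apply: ler_pM => //; [exact: fa|exact: gb].
rewrite ger0_norm ?invr_ge0 ?ler0n //.
have := normr_ge0 (\sum_(y <- nbrs x) (f y - f x) * (g y - g x)).
by move: h1; set A := `|_|; set B := _ * _; lra.
Qed.

Lemma Gamma2_quad f g (s : R) x :
  Gamma2 (fun y => f y + s * g y) (fun y => f y + s * g y) x =
  Gamma2 f f x + s * (2 * Gamma2 f g x) + s ^+ 2 * Gamma2 g g x.
Proof.
pose k y := f y + s * g y.
have Lk : laplacian k = fun y => laplacian f y + s * laplacian g y.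
  by apply/funext => y; rewrite laplacianD laplacianZ.
have Gk : Gamma k k = fun y => Gamma f f y + (s * (2 * Gamma f g y)
   + s ^+ 2 * Gamma g g y).
  apply/funext => y; rewrite GammaDl !GammaDr !GammaZl !GammaZr (GammaC g f).
  ring.
have L2 : laplacian (Gamma k k) x = laplacian (Gamma f f) x
   + (s * (2 * laplacian (Gamma f g) x) + s ^+ 2 * laplacian (Gamma g g) x).
  by rewrite Gk laplacianD laplacianD !laplacianZ.
rewrite -/k /Gamma2 L2 Lk !GammaDl !GammaDr !GammaZl !GammaZr.
rewrite (GammaC f (laplacian g)); ring.
Qed.

(** [CD0oo] makes Gamma2 at [x] a positive semidefinite form, so the discriminant
    of its restriction to the plane of [f] and [g] is nonpositive. *)
Lemma Gamma2_Cauchy_Schwarz f g x (c : R) : CD0oo R G -> Gamma2 g g x <= c ->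
  (Gamma2 f g x) ^+ 2 <= Gamma2 f f x * c.
Proof.
move=> cd gc.
have a0 := cd f x; have b0 := cd g x.
have q s := cd (fun y => f y + s * g y) x.
have {}q s : 0 <= Gamma2 f f x + s * (2 * Gamma2 f g x)
    + s ^+ 2 * Gamma2 g g x by rewrite -Gamma2_quad; exact: q.
move: (Gamma2 f f x) (Gamma2 f g x) (Gamma2 g g x) a0 b0 q gc => a m b a0 b0 q bc.
apply: (@le_trans _ _ (a * b)); last exact: ler_wpM2l.
have [b_eq|b_neq] := eqVneq b 0.
  (* If g is isotropic, the form is affine and nonnegative on the line f + s g,
     hence constant. *)
  rewrite b_eq in q *; have [->|m_neq] := eqVneq m 0; first by rewrite expr0n /= mulr0.
  have := q (- (a + 1) / (2 * m)).
  have -> : a + - (a + 1) / (2 * m) * (2 * m) + (- (a + 1) / (2 * m)) ^+ 2 * 0 = -1.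
    by field.
  by rewrite ler0N1.
have := q (- m / b).
have -> : a + - m / b * (2 * m) + (- m / b) ^+ 2 * b = (a * b - m ^+ 2) / b by field.
by rewrite pmulr_lge0 ?subr_ge0 // invr_gt0 lt_neqAle eq_sym b_neq b0.
Qed.

(** All the summations by parts below reduce to this one: the edges inside [S] cancel
    in pairs, and the hypothesis on [a] removes those that leave [S]. *)
Lemma sum_antisym S (a : G -> G -> R) : uniq S ->
  (forall w y, a w y = - a y w) ->
  (forall w y, y \in nbrs w -> w \in S -> y \notin S -> a w y = 0) ->
  \sum_(w <- S) \sum_(y <- nbrs w) a w y = 0.
Proof.
move=> uS anti out.
have E : \sum_(w <- S) \sum_(y <- nbrs w) a w y =
         \sum_(w <- S) \sum_(y <- S | adj w y) a w y.
  apply: eq_big_seq => w wS.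
  rewrite (bigID (mem S)) /= [X in _ + X]big1_seq ?addr0; last first.
    by move=> y /andP[yS yw]; exact: out.
  rewrite -big_filter -[RHS]big_filter; apply: perm_big.
  apply: uniq_perm; rewrite ?filter_uniq ?nbrs_uniq // => y.
  by rewrite !mem_filter mem_nbrs /= andbC.
have : \sum_(w <- S) \sum_(y <- S | adj w y) a w y =
   - \sum_(w <- S) \sum_(y <- S | adj w y) a w y.
  rewrite {1}(exchange_big_dep xpredT) //= -sumrN; apply: eq_bigr => w _.
  rewrite -sumrN; apply: eq_big => [y|y _]; first by rewrite adj_sym.
  by rewrite anti.
rewrite E => h; lra.
Qed.

(** A function supported on such vertices of [S] has no boundary terms in a
    summation by parts over [S]. *)
Definition inner_vertex S w := w \in S /\ forall y, y \in nbrs w -> y \in S.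

Lemma sum_Gamma S f g : uniq S ->
  (forall w, f w != 0 -> inner_vertex S w) ->
  \sum_(w <- S) Gamma f g w = - \sum_(w <- S) f w * laplacian g w.
Proof.
move=> uS fS; apply/eqP; rewrite -subr_eq0 opprK -big_split /=.
have -> : \sum_(w <- S) (Gamma f g w + f w * laplacian g w) =
  \sum_(w <- S) \sum_(y <- nbrs w) 2^-1 * ((f y + f w) * (g y - g w)).
  apply: eq_bigr => w _; rewrite GammaE laplacianE !mulr_sumr -big_split /=.
  by apply: eq_bigr => y _; field.
apply/eqP; apply: sum_antisym => // [w y|w y yw wS yS]; first by ring.
have -> : f y = 0.
  by apply/eqP/negPn/negP => /fS[]; rewrite (negbTE yS).
have -> : f w = 0.
  by apply/eqP/negPn/negP => /fS[_] /(_ _ yw); rewrite (negbTE yS).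
by rewrite addr0 mul0r mulr0.
Qed.

Lemma sum_laplacian S f : uniq S ->
  (forall w, f w != 0 -> inner_vertex S w) ->
  \sum_(w <- S) laplacian f w = 0.
Proof.
move=> uS fS.
under eq_bigr do rewrite laplacianE.
apply: sum_antisym => // [w y|w y yw wS yS]; first by ring.
have -> : f y = 0.
  by apply/eqP/negPn/negP => /fS[]; rewrite (negbTE yS).
have -> : f w = 0.
  by apply/eqP/negPn/negP => /fS[_] /(_ _ yw); rewrite (negbTE yS).
by rewrite subr0.
Qed.

Lemma sum_laplacianC S f g : uniq S ->
  (forall w, f w != 0 -> inner_vertex S w) ->
  \sum_(w <- S) laplacian f w * g w = \sum_(w <- S) f w * laplacian g w.
Proof.
move=> uS fS; apply/eqP; rewrite -subr_eq0 -sumrB.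
have -> : \sum_(w <- S) (laplacian f w * g w - f w * laplacian g w) =
  \sum_(w <- S) \sum_(y <- nbrs w) (f y * g w - f w * g y).
  apply: eq_bigr => w _; rewrite !laplacianE mulr_suml mulr_sumr -sumrB /=.
  by apply: eq_bigr => y _; ring.
apply/eqP; apply: sum_antisym => // [w y|w y yw wS yS]; first by ring.
have -> : f y = 0.
  by apply/eqP/negPn/negP => /fS[]; rewrite (negbTE yS).
have -> : f w = 0.
  by apply/eqP/negPn/negP => /fS[_] /(_ _ yw); rewrite (negbTE yS).
by rewrite !mul0r subr0.
Qed.

(** The closed ball of radius [n] as a list with repetitions, which keeps its
    size bound [size_cball] immediate. *)
Fixpoint cball n x : seq G :=
  if n is n'.+1 then flatten [seq w :: nbrs w | w <- cball n' x] else [:: x].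

Lemma cballS n x w y : w \in cball n x -> y = w \/ y \in nbrs w ->
  y \in cball n.+1 x.
Proof.
move=> wn yw; apply/flattenP; exists (w :: nbrs w); first exact: map_f.
by rewrite inE; case: yw => [->|->]; rewrite ?eqxx ?orbT.
Qed.

Lemma cballSP n x y : y \in cball n.+1 x ->
  exists2 w, w \in cball n x & y = w \/ y \in nbrs w.
Proof.
move=> /flattenP[s /mapP[w wn ->]]; rewrite inE => /orP[/eqP ->|yw].
  by exists w => //; left.
by exists w => //; right.
Qed.

Lemma size_cball n x : (size (cball n x) <= D.+1 ^ n)%N.
Proof.
elim: n => [//|n IH] /=.
have : (size (flatten [seq w :: nbrs w | w <- cball n x])
   <= size (cball n x) * D.+1)%N.
  elim: (cball n x) => [//|w s IHs] /=.
  rewrite size_cat mulSn -addSn leq_add // ltnS.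
  by case: degD => _ /(_ w)[].
by move=> h; apply: leq_trans h _; rewrite expnSr leq_mul2r IH orbT.
Qed.

Lemma cball_center n x : x \in cball n x.
Proof.
elim: n => [|n IH]; first by rewrite inE.
by apply: cballS IH _; left.
Qed.

Definition ball2 x : seq G := undup (cball 2 x).

End Calculus.

(** * The curvature form dominates the Laplacian *)

Section Dimension.
Variables (R : realType) (G : sgraph) (D : nat).
Hypothesis degD : degree_bound G D.
Implicit Types (x y z w : G) (f g u : G -> R) (S : seq G).

Definition delta x y : R := (y == x)%:R.

Lemma sum_delta (s : seq G) (a : G -> R) x : uniq s ->
  \sum_(z <- s) delta x z * a z = (x \in s)%:R * a x.
Proof.
move=> us; case: (boolP (x \in s)) => xs.
  rewrite (bigD1_seq x) //= /delta eqxx big1 ?addr0 // => z /negbTE ->.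
  by rewrite mul0r.
rewrite big1_seq ?mul0r // => z /= zs; rewrite /delta.
by case: eqP zs => [->|]; rewrite ?(negbTE xs) ?mul0r.
Qed.

Lemma Gamma_delta_center f x : Gamma (delta x) f x = - 2^-1 * laplacian f x.
Proof.
rewrite (GammaE degD) (laplacianE degD) !mulr_sumr; apply: eq_big_seq => y yx.
have -> : delta x y = 0.
  by rewrite /delta; case: eqP yx => // ->; rewrite (nbrs_irr degD).
by rewrite /delta eqxx /=; ring.
Qed.

Lemma Gamma_delta_nbr f x y : y \in nbrs x ->
  Gamma f (delta x) y = 2^-1 * (f x - f y).
Proof.
move=> yx; rewrite (GammaE degD); congr (_ * _).
have -> : delta x y = 0.
  by rewrite /delta; case: eqP yx => // ->; rewrite (nbrs_irr degD).
under eq_bigr do rewrite subr0 mulrC.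
by rewrite (sum_delta (fun z => f z - f y)) ?nbrs_uniq // -(nbrs_sym degD) yx mul1r.
Qed.

Lemma laplacian_delta_center x : laplacian (delta x) x = - (size (nbrs x))%:R.
Proof.
rewrite (laplacianE degD) (eq_big_seq (fun=> - 1)) => [|y yx].
  by rewrite big_const_seq count_predT iter_addr_0 mulNrn.
have -> : delta x y = 0.
  by rewrite /delta; case: eqP yx => // ->; rewrite (nbrs_irr degD).
by rewrite /delta eqxx sub0r.
Qed.

Lemma laplacian_delta_nbr x y : y \in nbrs x -> laplacian (delta x) y = 1.
Proof.
move=> yx; rewrite (laplacianE degD).
have -> : delta x y = 0.
  by rewrite /delta; case: eqP yx => // ->; rewrite (nbrs_irr degD).
under eq_bigr do rewrite subr0 -[delta _ _]mulr1.
by rewrite (sum_delta (fun=> 1)) ?nbrs_uniq // -(nbrs_sym degD) yx mul1r.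
Qed.

(** First of the two identities behind the dimension bound: at the vertex itself the
    degree cancels, and only iterated Laplacians of [f] remain. *)
Lemma Gamma2_delta_center f x :
  4 * Gamma2 f (delta x) x = laplacian (laplacian f) x - 2 * laplacian f x.
Proof.
rewrite /Gamma2 Gamma_delta_center.
have -> : laplacian (Gamma f (delta x)) x =
    2^-1 * ((size (nbrs x))%:R - 1) * laplacian f x.
  rewrite (laplacianE degD) (eq_big_seq (fun y => - 2^-1 * (f y - f x)
     + 2^-1 * laplacian f x)) => [|y yx]; last first.
    by rewrite Gamma_delta_nbr // (GammaC degD) Gamma_delta_center; ring.
  rewrite big_split /= -mulr_sumr -(laplacianE degD).
  rewrite big_const_seq count_predT iter_addr_0 -[_ *+ size _]mulr_natl; ring.
have -> : Gamma f (laplacian (delta x)) x =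
    2^-1 * ((size (nbrs x))%:R + 1) * laplacian f x.
  rewrite (GammaE degD) (laplacianE degD f) -mulrA; congr (_ * _).
  rewrite mulr_sumr; apply: eq_big_seq => y yx.
  by rewrite laplacian_delta_nbr // laplacian_delta_center; ring.
by field.
Qed.

Lemma mem_ball2 x y : (y \in ball2 x) = (y \in cball 2 x).
Proof. by rewrite mem_undup. Qed.

Lemma ball2_uniq x : uniq (ball2 x).
Proof. exact: undup_uniq. Qed.

Lemma size_ball2 x : (size (ball2 x) <= D.+1 ^ 2)%N.
Proof. by apply: leq_trans (size_undup _) _; exact: size_cball. Qed.

Lemma cball1E x y : y = x \/ y \in nbrs x -> y \in cball 1 x.
Proof. by move=> ?; apply: (cballS (w := x)) => //; rewrite inE. Qed.

Lemma inner_vertex_ball2 x w : w = x \/ w \in nbrs x -> inner_vertex (ball2 x) w.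
Proof.
move=> /cball1E w1; split=> [|y yw]; rewrite mem_ball2.
  by apply: cballS w1 _; left.
by apply: cballS w1 _; right.
Qed.

Lemma delta_inner_vertex x w : delta x w != 0 -> inner_vertex (ball2 x) w.
Proof.
rewrite /delta; case: (w =P x) => [->|_]; last by rewrite eqxx.
by move=> _; apply: inner_vertex_ball2; left.
Qed.

Lemma not_near x w : ~ (w = x \/ w \in nbrs x) ->
  delta x w = 0 /\ forall y, y \in nbrs w -> delta x y = 0.
Proof.
move=> nw; split=> [|y yw]; rewrite /delta; case: eqP => // h; exfalso; apply: nw.
  by left.
by right; rewrite (nbrs_sym degD) -h.
Qed.

(** Second identity.  Integrated over the graph, Gamma2(f, g) is the integral of
    laplacian f times laplacian g; for [g = delta x] this is the bilaplacian of [f] at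
    [x], and nothing outside [ball2 x] contributes. *)
Lemma sum_Gamma2_delta f x :
  \sum_(w <- ball2 x) Gamma2 f (delta x) w = laplacian (laplacian f) x.
Proof.
have us := ball2_uniq x.
have dx := @delta_inner_vertex x.
have sumx (a : G -> R) : \sum_(w <- ball2 x) delta x w * a w = a x.
  by rewrite sum_delta // mem_ball2 cball_center mul1r.
have near w (P : Prop) : (delta x w = 0 -> (forall y, y \in nbrs w -> delta x y = 0)
   -> P) -> ~ P -> inner_vertex (ball2 x) w.
  move=> h nP; have [nr|nr] := pselect (w = x \/ w \in nbrs x).
    exact: inner_vertex_ball2.
  by have [h1 h2] := not_near nr; case: nP; exact: h.
have lapx w : laplacian (delta x) w != 0 -> inner_vertex (ball2 x) w.
  move=> /eqP; apply: near => d0 dn; rewrite (laplacianE degD) big1_seq // => y /= yw.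
  by rewrite d0 dn ?subr0.
have Gx w : Gamma f (delta x) w != 0 -> inner_vertex (ball2 x) w.
  move=> /eqP; apply: near => d0 dn;
    rewrite (GammaE degD) big1_seq ?mulr0 // => y /= yw.
  by rewrite d0 dn ?subr0 ?mulr0.
rewrite /Gamma2 -mulr_sumr !sumrB (sum_laplacian degD) //.
under [in X in _ - X - _]eq_bigr do rewrite (GammaC degD).
rewrite (sum_Gamma degD) // (sum_laplacianC degD) // sumx.
by rewrite (sum_Gamma degD) // sumx; field.
Qed.

Lemma norm_slope_le f (c : R) x y :
  `|f y| <= c -> `|f x| <= c -> `|f y - f x| <= 2 * c.
Proof.
by move=> hy hx; apply: le_trans (ler_normB _ _) _; lra.
Qed.

Lemma Gamma2_delta_le x w : Gamma2 (delta x) (delta x) w <= 4 * D%:R ^+ 2.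
Proof.
have D1 : 1 <= D%:R :> R := degree_bound_ge1 R degD.
have D0 : 0 <= D%:R :> R by lra.
have s1 y z : `|delta x y - delta x z| <= 1.
  by rewrite /delta; do 2 case: eqP => _ /=;
    rewrite ?subrr ?sub0r ?subr0 ?normrN ?normr0 ?normr1.
have L y : `|laplacian (delta x) y| <= D%:R.
  by rewrite (laplacianE degD) -[leRHS]mulr1; apply: norm_sum_nbrs_le.
have G1 y : `|Gamma (delta x) (delta x) y| <= D%:R.
  by rewrite -(mulr1 D%:R) -(mulr1 (D%:R * 1)) -mulrA; apply: (Gamma_le_slope degD).
have LG : `|laplacian (Gamma (delta x) (delta x)) w| <= D%:R * (2 * D%:R).
  rewrite (laplacianE degD); apply: (norm_sum_nbrs_le degD) => [|y _].
    by lra.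
  exact: norm_slope_le.
have GL : `|Gamma (delta x) (laplacian (delta x)) w| <= D%:R * (1 * (2 * D%:R)).
  by apply: (Gamma_le_slope degD) => // y _; exact: norm_slope_le.
rewrite /Gamma2.
move: LG GL => /ler_normlP[_ LG] /ler_normlP[GL _].
move: LG GL; set a := laplacian _ _; set b := Gamma _ _ _; nra.
Qed.

Definition dim_const : R := 16 * (D.+1 ^ 2)%:R * D%:R ^+ 2.

Lemma sqr_sum_le (s : seq G) (a : G -> R) :
  (\sum_(w <- s) a w) ^+ 2 <= (size s)%:R * \sum_(w <- s) a w ^+ 2.
Proof.
elim: s => [|w s IH]; first by rewrite !big_nil expr0n /= mul0r.
rewrite !big_cons /= -natr1.
set A := \sum_(j <- s) a j in IH *; set B := \sum_(j <- s) _ in IH *.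
set n := (size s)%:R in IH *.
have [n0|n0] := eqVneq n 0.
  rewrite n0 mul0r in IH.
  have A0 : A = 0.
    by apply/eqP; rewrite -(sqrf_eq0 A); apply/eqP; apply/le_anti; rewrite IH sqr_ge0.
  rewrite A0 addr0 n0 add0r mul1r lerDl.
  by rewrite /B sumr_ge0 // => i _; rewrite sqr_ge0.
have n1 : 0 < n by rewrite lt_neqAle eq_sym n0 /n ler0n.
have h : 0 <= (n * a w - A) ^+ 2 by rewrite sqr_ge0.
have h2 : 0 <= n * a w ^+ 2 + A ^+ 2 / n - 2 * a w * A.
  have -> : n * a w ^+ 2 + A ^+ 2 / n - 2 * a w * A = (n * a w - A) ^+ 2 / n by field.
  by rewrite divr_ge0 // ltW.
have h3 : A ^+ 2 / n <= B by rewrite ler_pdivrMr // mulrC.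
have -> : (n + 1) * (a w ^+ 2 + B) = n * a w ^+ 2 + a w ^+ 2 + n * B + B by ring.
have -> : (a w + A) ^+ 2 = a w ^+ 2 + 2 * a w * A + A ^+ 2 by ring.
lra.
Qed.

(** The dimension inequality.  Eliminating the bilaplacian from the two
    identities writes the Laplacian of [f] at [x] as a combination of the numbers
    Gamma2(f, delta x)(w) with coefficients bounded by 2, and Cauchy-Schwarz bounds
    each of them by Gamma2(f)(w). *)
Lemma sqr_laplacian_le f x : CD0oo R G ->
  (laplacian f x) ^+ 2 <= dim_const * \sum_(w <- ball2 x) Gamma2 f f w.
Proof.
move=> cd.
have e1 := Gamma2_delta_center f x; have e2 := sum_Gamma2_delta f x.
pose c w : R := 2^-1 - 2 * delta x w.
have -> : laplacian f x = \sum_(w <- ball2 x) c w * Gamma2 f (delta x) w.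
  under eq_bigr do rewrite mulrBl -mulrA.
  rewrite sumrB -[X in X - _]mulr_sumr -[X in _ - X]mulr_sumr sum_delta ?ball2_uniq // mem_ball2 cball_center.
  by rewrite e2 mul1r; move: e1; lra.
apply: le_trans (sqr_sum_le _ _) _.
have c2 w : c w ^+ 2 <= 4.
  by rewrite /c /delta; case: eqP => _ /=; rewrite expr2; lra.
have -> : dim_const * \sum_(w <- ball2 x) Gamma2 f f w =
   (D.+1 ^ 2)%:R * \sum_(w <- ball2 x) 4 * (Gamma2 f f w * (4 * D%:R ^+ 2)).
  rewrite -mulr_sumr -mulr_suml /dim_const; ring.
apply: ler_pM; rewrite ?ler0n ?ler_nat ?size_ball2 //.
  by rewrite sumr_ge0 // => w _; rewrite sqr_ge0.
apply: ler_sum => w _; rewrite exprMn; apply: ler_pM; rewrite ?sqr_ge0 //.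
by apply: (Gamma2_Cauchy_Schwarz degD) => //; exact: Gamma2_delta_le.
Qed.

End Dimension.

(** * Euler steps of the nonlinear heat flow and time windows *)

Section Step.
Variables (R : realType) (G : sgraph) (D : nat).
Hypothesis degD : degree_bound G D.
Implicit Types (x y z w : G) (f g u : G -> R) (h : R).

Definition flow_speed u x : R := laplacian u x + Gamma u u x.
Definition flow_step h u x : R := u x + h * flow_speed u x.
(** An Euler step of length [h] for the generator g |-> laplacian g + 2 Gamma u g,
    written as a Markov chain with jump rates [1 + (u y - u x)].  This generator is the
    linearization of the flow at [u]. *)
Definition tilted h u g x : R :=
  g x + h * \sum_(y <- nbrs x) (1 + (u y - u x)) * (g y - g x).

Lemma tiltedE h u g x :
  tilted h u g x = g x + h * (laplacian g x + 2 * Gamma u g x).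
Proof.
rewrite /tilted (laplacianE degD) (GammaE degD) mulrA divff ?pnatr_eq0 // mul1r.
by rewrite -big_split /=; congr (_ + _ * _); apply: eq_bigr => y _; ring.
Qed.

(** There is no error term, because the Laplacian is linear: the definition of
    Gamma2 turns the Laplacian of [Gamma u u] into a transport term and Gamma2. *)
Lemma laplacian_step h u x : laplacian (flow_step h u) x =
  tilted h u (laplacian u) x + 2 * h * Gamma2 u u x.
Proof.
rewrite tiltedE /flow_step (laplacianD degD)
  (laplacianZ degD) /flow_speed (laplacianD degD).
by rewrite /Gamma2; field.
Qed.

(** As in [laplacian_step], by the definition of Gamma2; the last term is the
    discretization error. *)
Lemma Gamma_step h u x : Gamma (flow_step h u) (flow_step h u) x =
  tilted h u (Gamma u u) x - 2 * h * Gamma2 u u x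
  + h ^+ 2 * Gamma (flow_speed u) (flow_speed u) x.
Proof.
rewrite tiltedE /flow_step.
have : Gamma u (flow_speed u) x = Gamma u (laplacian u) x
    + Gamma u (Gamma u u) x by rewrite -(GammaDr degD).
move: (flow_speed u) => v Ev.
rewrite (GammaDl degD) !(GammaDr degD _ u (fun y => h * v y)) !(GammaZl degD h).
rewrite !(GammaZr degD h _ v) (GammaC degD v u) Ev /Gamma2; by field.
Qed.

Lemma flow_step_tilted h u x :
  flow_step h u x = tilted h u u x - h * Gamma u u x.
Proof. by rewrite tiltedE /flow_step /flow_speed; ring. Qed.

Lemma tiltedDZ h u f (c : R) g x :
  tilted h u (fun y => f y + c * g y) x = tilted h u f x + c * tilted h u g x.
Proof.
by rewrite !tiltedE (laplacianD degD) (laplacianZ degD) (GammaDr degD)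
  (GammaZr degD); ring.
Qed.

Lemma tilted_lin h u (a b : R) f g x :
  tilted h u (fun y => a * f y + b * g y) x =
  a * tilted h u f x + b * tilted h u g x.
Proof.
rewrite !tiltedE (laplacianD degD) !(laplacianZ degD) (GammaDr degD) !(GammaZr degD);
  ring.
Qed.

Lemma tiltedN h u (A : R) g x :
  tilted h u (fun y => A - g y) x = A - tilted h u g x.
Proof.
rewrite /tilted; have -> : \sum_(y <- nbrs x) (1 + (u y - u x)) * (A - g y - (A - g x))
  = - \sum_(y <- nbrs x) (1 + (u y - u x)) * (g y - g x).
  by rewrite -sumrN; apply: eq_bigr => y _; ring.
by ring.
Qed.

(** With slopes at most 1/2 the rates lie between 1/2 and 3/2, so a step keeps
    nonnegativity, with quantitative weights at the vertex and its neighbours. *)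
Lemma tilted_ge h u g x : 0 <= h ->
  (forall y, y \in nbrs x -> `|u y - u x| <= 2^-1) ->
  (forall y, 0 <= g y) ->
  (1 - 2 * D%:R * h) * g x + h / 2 * \sum_(y <- nbrs x) g y <= tilted h u g x.
Proof.
move=> h0 sl g0.
have -> : (1 - 2 * D%:R * h) * g x + h / 2 * \sum_(y <- nbrs x) g y
  = g x + h * (2^-1 * \sum_(y <- nbrs x) g y - D%:R * (2 * g x)) by field.
rewrite lerD2l ler_wpM2l // lerBlDr mulr_sumr.
apply: (@le_trans _ _ (\sum_(y <- nbrs x) ((1 + (u y - u x)) * (g y - g x) + 2 * g x))).
  rewrite big_seq [leRHS]big_seq; apply: ler_sum => y /sl /ler_normlP[s1 s2].
  by have := g0 x; have := g0 y; nra.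
rewrite big_split /= lerD2l; apply: (sum_nbrs_le degD) => //.
by have := g0 x; lra.
Qed.

(** The maximum principle: the new value is an average of old ones. *)
Lemma tilted_le h u g (A : R) x : 0 <= h -> 2 * D%:R * h <= 1 ->
  (forall y, y \in nbrs x -> `|u y - u x| <= 2^-1) ->
  (forall y, g y <= A) -> tilted h u g x <= A.
Proof.
move=> h0 hD sl gA; rewrite -subr_ge0 -tiltedN.
apply: le_trans (tilted_ge (g := fun y => A - g y) h0 sl _); last first.
  by move=> y; rewrite subr_ge0.
apply: addr_ge0; first by rewrite mulr_ge0 ?subr_ge0.
rewrite mulr_ge0 ?divr_ge0 // sumr_ge0 // => y _; by rewrite subr_ge0.
Qed.

End Step.

(** [P] is a nonnegative supersolution and [Q] the gain that it collects.  In one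
    step of length [h] hardly anything moves to a neighbour, so the effect of
    the gain at distance at most 2 is measured over a window of [3 * J] steps:
    [J] steps to collect it, and [J] steps for each of the two edges that
    separate it from [x].  The length [tau] of [J] steps is small compared with
    [1 / D], so that at least half of the mass at a vertex stays there. *)
Section Window.
Variables (R : realType) (G : sgraph) (D : nat).
Hypothesis degD : degree_bound G D.
Implicit Types (x y z w : G).
Variables (h tau : R) (J : nat) (P Q : nat -> G -> R).
Hypothesis h0 : 0 <= h.
Hypothesis hJ : h * J%:R = tau.
Hypothesis tauD : 12 * D%:R * tau <= 1.
Hypothesis P0 : forall x, 0 <= P 0%N x.
Hypothesis Q0 : forall j x, (j < 3 * J)%N -> 0 <= Q j x.
Hypothesis step : forall j, (j < 3 * J)%N -> (forall y, 0 <= P j y) ->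
  forall x, (1 - 2 * D%:R * h) * P j x + h / 2 * \sum_(y <- nbrs x) P j y
    + h * Q j x <= P j.+1 x.

Let S j x := 2^-1 * \sum_(y <- nbrs x) P j y + Q j x.

Let a := 2 * D%:R * h.

Let a0 : 0 <= a.
Proof. by rewrite !mulr_ge0. Qed.

Let na n : (n <= 3 * J)%N -> n%:R * a <= 2^-1.
Proof.
move=> nJ; apply: (@le_trans _ _ ((3 * J)%:R * a)); first
  by rewrite ler_wpM2r // ler_nat.
by rewrite natrM /a; move: tauD; rewrite -hJ; lra.
Qed.

Lemma window_ge0 j x : (j <= 3 * J)%N -> 0 <= P j x.
Proof.
elim: j x => [//|j IH] x jJ.
have Pj y : 0 <= P j y by apply: IH; exact: ltnW.
apply: le_trans (step jJ Pj x); have := na jJ; rewrite -natr1 => n1.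
have aj : 0 <= j%:R * a by rewrite mulr_ge0.
rewrite !addr_ge0 //; last by rewrite mulr_ge0 ?Q0.
  by rewrite mulr_ge0 // -/a; lra.
by rewrite !mulr_ge0 ?invr_ge0 // sumr_ge0.
Qed.

Let S0 j x : (j < 3 * J)%N -> 0 <= S j x.
Proof.
move=> jJ; rewrite addr_ge0 ?Q0 // mulr_ge0 // ?invr_ge0 // sumr_ge0 // => y _.
by apply: window_ge0; exact: ltnW.
Qed.

Let grow n i x : (i + n <= 3 * J)%N ->
  (1 - n%:R * a) * (P i x + \sum_(k < n) h * S (i + k) x) <= P (i + n) x.
Proof.
elim: n => [|n IH] inJ; first by rewrite big_ord0 addr0 mul0r subr0 mul1r addn0.
have inJ' : (i + n < 3 * J)%N by rewrite addnS in inJ.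
have {}IH := IH (ltnW inJ').
have st : (1 - a) * P (i + n) x + h * S (i + n) x <= P (i + n).+1 x.
  apply: le_trans (step inJ' (fun y => window_ge0 y (ltnW inJ')) x).
  by rewrite /S -/a; lra.
rewrite addnS; apply: le_trans st; rewrite big_ord_recr /=.
have s0 : 0 <= h * S (i + n) x by rewrite mulr_ge0 ?S0.
have n1 := na (leq_trans (leq_addl i n.+1) inJ); rewrite -natr1 in n1 *.
have n0 : 0 <= n%:R * a by rewrite mulr_ge0.
have sum0 : 0 <= P i x + \sum_(k < n) h * S (i + k) x.
  rewrite addr_ge0 ?window_ge0 //; first by lia.
  by rewrite sumr_ge0 // => k _; rewrite mulr_ge0 ?S0 //; case: k => k /=; lia.
move: IH s0 sum0; set U := P i x + _ ; rewrite addrA -/U.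
set s := h * _; set V := P (i + n) x => IH s0 U0.
have : (1 - a) * ((1 - n%:R * a) * U) <= (1 - a) * V by apply: ler_wpM2l => //; lra.
have : 0 <= a * (n%:R * a) * U by rewrite !mulr_ge0.
have : 0 <= (n%:R + 1) * a * s by apply: mulr_ge0 => //; apply: mulr_ge0 => //;
  apply: addr_ge0.
lra.
Qed.

Let grow2 n i x : (i + n <= 3 * J)%N ->
  2^-1 * (P i x + \sum_(k < n) h * S (i + k) x) <= P (i + n) x.
Proof.
move=> inJ; apply: le_trans (grow x inJ); apply: ler_wpM2r; last first.
  by have := na (leq_trans (leq_addl i n) inJ); lra.
rewrite addr_ge0 ?window_ge0 //; first by lia.
by rewrite sumr_ge0 // => k _; rewrite mulr_ge0 ?S0 //; case: k => k /=; lia.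
Qed.

Lemma window_half n i x : (i + n <= 3 * J)%N -> 2^-1 * P i x <= P (i + n) x.
Proof.
move=> inJ; apply: le_trans (grow2 x inJ).
rewrite ler_wpM2l ?invr_ge0 // lerDl sumr_ge0 // => k _.
by rewrite mulr_ge0 ?S0 //; case: k => k /=; lia.
Qed.

Let tau0 : 0 <= tau. Proof. by rewrite -hJ mulr_ge0. Qed.

Let tau1 : tau <= 1.
Proof. by have := degree_bound_ge1 R degD; move: tauD tau0; nra. Qed.

Lemma window_spread i x y : (i + J <= 3 * J)%N -> y = x \/ y \in nbrs x ->
  tau / 8 * P i y <= P (i + J) x.
Proof.
move=> iJ [->|yx].
  apply: le_trans (window_half x iJ); apply: ler_wpM2r; last by move: tau1; lra.
  by apply: window_ge0; lia.
apply: le_trans (grow2 x iJ).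
have -> : tau / 8 * P i y = 2^-1 * \sum_(k < J) h * (4^-1 * P i y).
  by rewrite sumr_const card_ord -mulr_natr -hJ; field.
rewrite ler_wpM2l ?invr_ge0 // -[leLHS]add0r lerD ?window_ge0 //; first by lia.
apply: ler_sum => k _; have kJ : (i + k < 3 * J)%N by case: k => k /=; lia.
apply: ler_wpM2l => //; rewrite /S -[leLHS]addr0 lerD ?Q0 //.
have := window_half y (ltnW kJ) => half.
have : P (i + k) y <= \sum_(y <- nbrs x) P (i + k) y.
  rewrite (bigD1_seq y) ?nbrs_uniq //= lerDl sumr_ge0 // => z _.
  by apply: window_ge0; exact: ltnW.
by lra.
Qed.

(** The gain at distance at most 2 during the first third of the window is felt
    at [x] at its end.  This is what makes the nonlocal dimension inequality
    usable in a maximum principle. *)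
Lemma window_gain x w : w \in ball2 x ->
  2^-1 * (tau / 8) ^+ 2 * (h * \sum_(j < J) Q j w) <= P (3 * J) x.
Proof.
rewrite mem_ball2 => /cballSP[y /cballSP[z]].
rewrite inE => /eqP -> yx wy.
have s1 : 2^-1 * (h * \sum_(j < J) Q j w) <= P J w.
  apply: le_trans (@grow2 J 0%N w _); last by lia.
  rewrite ler_wpM2l ?invr_ge0 // mulr_sumr -[leLHS]add0r lerD //.
  apply: ler_sum => k _; apply: ler_wpM2l => //.
  rewrite add0n /S lerDr mulr_ge0 ?invr_ge0 // sumr_ge0 // => v _.
  by apply: window_ge0; case: k => k /=; lia.
have s2 : tau / 8 * P J w <= P (J + J) y by apply: window_spread => //; lia.
have s3 : tau / 8 * P (J + J)%N y <= P (J + J + J) x by apply: window_spread => //; lia.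
have -> : (3 * J = J + J + J)%N by lia.
have t8 : 0 <= tau / 8 by rewrite divr_ge0.
move: (tau / 8) t8 s2 s3 => t t8 s2 s3.
have -> : 2^-1 * t ^+ 2 * (h * \sum_(j < J) Q j w) =
  t * (t * (2^-1 * (h * \sum_(j < J) Q j w))) by ring.
apply: le_trans s3; apply: ler_wpM2l => //; apply: le_trans s2.
exact: ler_wpM2l.
Qed.

End Window.

(** * Estimates along the flow *)

Section Flow.
Variables (R : realType) (G : sgraph) (D : nat).
Hypothesis degD : degree_bound G D.
Hypothesis cd : CD0oo R G.
Implicit Types (x y z w : G) (f g u : G -> R).

Let D1 : 1 <= D%:R :> R := degree_bound_ge1 R degD.

Let Gamma2_ge0 f x : 0 <= Gamma2 f f x. Proof. exact: cd. Qed.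

Lemma slope_of_Gamma u (E s : R) x y : (forall z, Gamma u u z <= E) ->
  0 <= s -> 2 * E <= s ^+ 2 -> y \in nbrs x -> `|u y - u x| <= s.
Proof.
move=> uE s0 Es yx; rewrite -(@ler_pXn2r _ 2) ?nnegrE // real_normK ?num_real //.
apply: le_trans (sqr_slope_le_Gamma degD u yx) _.
by apply: le_trans Es; have := uE x; lra.
Qed.

Lemma slope_le_half u (E : R) x y : E <= 8^-1 -> (forall z, Gamma u u z <= E) ->
  y \in nbrs x -> `|u y - u x| <= 2^-1.
Proof.
by move=> E8 uE; apply: (slope_of_Gamma uE); rewrite ?invr_ge0 //; lra.
Qed.

Lemma Gamma_speed_le u (E : R) x : E <= 8^-1 -> (forall z, Gamma u u z <= E) ->
  Gamma (flow_speed u) (flow_speed u) x <= 4 * D%:R ^+ 3.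
Proof.
move=> E8 uE.
have sl z y : y \in nbrs z -> `|u y - u z| <= 2^-1.
  exact: slope_le_half E8 uE.
have sp z : `|flow_speed u z| <= D%:R.
  rewrite /flow_speed; apply: le_trans (ler_normD _ _) _.
  have : `|laplacian u z| <= D%:R * 2^-1.
    by rewrite (laplacianE degD); apply: (norm_sum_nbrs_le degD);
      rewrite ?invr_ge0 // => y; exact: sl.
  have := uE z; have := Gamma_ge0 degD u z => g0 gE.
  by rewrite (ger0_norm g0); move: D1; lra.
have -> : 4 * D%:R ^+ 3 = D%:R * ((2 * D%:R) * (2 * D%:R)) :> R by ring.
apply: le_trans (ler_norm _) _.
by apply: (Gamma_le_slope degD) => // y _; exact: norm_slope_le.
Qed.

Variables (h E M : R) (u0 : G -> R) (N : nat).
Hypothesis h0 : 0 <= h.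
Hypothesis hD : 2 * D%:R * h <= 1.
Hypothesis E8 : E <= 8^-1.
Hypothesis u0E : forall x, Gamma u0 u0 x <= E / 2.
Hypothesis NE : N%:R * (4 * D%:R ^+ 3 * h ^+ 2) <= E / 2.

Definition flow k := iter k (flow_step h) u0.

(** By the maximum principle Gamma does not increase along the exact flow; the
    Euler scheme at most doubles it within [N] steps. *)
Lemma Gamma_flow_le k x : (k <= N)%N -> Gamma (flow k) (flow k) x <= E.
Proof.
have e0 : 0 <= 4 * D%:R ^+ 3 * h ^+ 2 by rewrite !mulr_ge0 ?exprn_ge0.
suff main : (k <= N)%N -> forall x, Gamma (flow k) (flow k) x <=
    E / 2 + k%:R * (4 * D%:R ^+ 3 * h ^+ 2).
  move=> kN; apply: le_trans (main kN x) _.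
  have : k%:R * (4 * D%:R ^+ 3 * h ^+ 2) <= N%:R * (4 * D%:R ^+ 3 * h ^+ 2).
    by rewrite ler_wpM2r // ler_nat.
  by move: NE; lra.
elim: k {x} => [|k IH] kN x; first by rewrite mul0r addr0; exact: u0E.
have {}IH := IH (ltnW kN).
have IHE z : Gamma (flow k) (flow k) z <= E.
  apply: le_trans (IH z) _.
  have : k%:R * (4 * D%:R ^+ 3 * h ^+ 2) <= N%:R * (4 * D%:R ^+ 3 * h ^+ 2).
    by rewrite ler_wpM2r // ler_nat ltnW.
  by move: NE; lra.
rewrite /= (Gamma_step degD).
have t1 : tilted h (flow k) (Gamma (flow k) (flow k)) x <=
    E / 2 + k%:R * (4 * D%:R ^+ 3 * h ^+ 2).
  apply: (tilted_le degD) => // y; exact: slope_le_half E8 IHE.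
have t2 : 0 <= h * Gamma2 (flow k) (flow k) x by rewrite mulr_ge0 ?Gamma2_ge0.
have t3 : h ^+ 2 * Gamma (flow_speed (flow k)) (flow_speed (flow k)) x <=
    h ^+ 2 * (4 * D%:R ^+ 3).
  by rewrite ler_wpM2l ?exprn_ge0 //; exact: (Gamma_speed_le _ E8 IHE).
by rewrite -[k.+1%:R]natr1; move: t1 t2 t3; lra.
Qed.

Lemma flow_slope k x y : (k <= N)%N -> y \in nbrs x ->
  `|flow k y - flow k x| <= 2^-1.
Proof.
by move=> kN; apply: (slope_le_half E8) => z; exact: Gamma_flow_le.
Qed.

Lemma Gamma_flow_speed_le k x : (k <= N)%N ->
  Gamma (flow_speed (flow k)) (flow_speed (flow k)) x <= 4 * D%:R ^+ 3.
Proof. by move=> kN; apply: (Gamma_speed_le _ E8) => z; exact: Gamma_flow_le. Qed.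

(** Gamma is nonnegative, so the flow lies above the linear heat flow, which
    preserves lower bounds. *)
Lemma flow_ge k x : (forall y, - M <= u0 y) -> - M <= flow k x.
Proof.
move=> u0M; elim: k x => [|k IH] x; first exact: u0M.
rewrite /= /flow_step /flow_speed.
have : - laplacian (flow k) x <= D%:R * (flow k x + M).
  rewrite (laplacianE degD) -sumrN; apply: (sum_nbrs_le degD).
    by have := IH x; lra.
  by move=> y _; have := IH y; lra.
have := Gamma_ge0 degD (flow k) x; have := IH x.
move: (flow k x) (laplacian _ _) (Gamma _ _ _) => a l g am g0 la.
have : 0 <= h * g by rewrite mulr_ge0.
have : h * (- l) <= h * (D%:R * (a + M)) by rewrite ler_wpM2l.
have : 0 <= D%:R * h by rewrite mulr_ge0.
move=> Dh0; have : (D%:R * h) * (a + M) <= 1 * (a + M) by apply: ler_wpM2r; move: hD;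
  lra.
lra.
Qed.

(** Gradient decay.  Up to discretization errors, t Gamma(u) + u is a subsolution:
    the time derivative of the factor t contributes Gamma(u), which is the
    amount by which u falls short of solving the linearized equation. *)
Lemma flow_gradient x :
  N%:R * (D%:R * h ^+ 2 + N%:R * h * (4 * D%:R ^+ 3 * h ^+ 2)) <= 1 ->
  (forall y, u0 y <= 0) ->
  N%:R * h * Gamma (flow N) (flow N) x <= 1 - flow N x.
Proof.
move=> err u00.
set e := D%:R * h ^+ 2 + _ in err.
suff main k : (k <= N)%N -> forall y, flow k y + (k%:R * h) * Gamma (flow k)
  (flow k) y <= k%:R * e.
  by have := main N (leqnn N) x; lra.
elim: k => [|k IH] kN y; first by rewrite !mul0r addr0; exact: u00.
have {}IH := IH (ltnW kN); have kN' := ltnW kN.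
pose u := flow k; pose g := Gamma u u.
have sl z : z \in nbrs y -> `|u z - u y| <= 2^-1 by exact: flow_slope.
have t1 : tilted h u (fun z => u z + (k%:R * h) * g z) y <= k%:R * e.
  exact: (tilted_le degD).
rewrite (tiltedDZ degD) in t1.
have t2 : tilted h u g y <= g y + h * (D%:R * 1).
  rewrite /tilted lerD2l ler_wpM2l //;
    apply: (sum_nbrs_le degD) => // z /sl /ler_normlP[s1 s2].
  have := Gamma_flow_le z kN'; have := Gamma_flow_le y kN'.
  have := Gamma_ge0 degD u z; have := Gamma_ge0 degD u y;
    rewrite -/u -/g => a1 a2 a3 a4.
  have := E8; nra.
have t3 : 0 <= (k.+1%:R * h) * (2 * h * Gamma2 u u y) by do 2 (apply: mulr_ge0;
  first exact: mulr_ge0).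
have t4 : (k.+1%:R * h) * (h ^+ 2 * Gamma (flow_speed u) (flow_speed u) y)
   <= N%:R * h * (h ^+ 2 * (4 * D%:R ^+ 3)).
  apply: ler_pM; [exact: mulr_ge0|apply: mulr_ge0;
    [exact: exprn_ge0|exact: (Gamma_ge0 degD)]| |].
    by rewrite ler_wpM2r // ler_nat.
  by rewrite ler_wpM2l ?exprn_ge0 //; exact: Gamma_flow_speed_le.
have t5 : h * tilted h u g y <= h * (g y + h * (D%:R * 1)) by rewrite ler_wpM2l.
have -> : flow k.+1 y = tilted h u u y - h * g y by rewrite -(flow_step_tilted degD).
have -> : Gamma (flow k.+1) (flow k.+1) y = tilted h u g y - 2 * h * Gamma2 u u y
  + h ^+ 2 * Gamma (flow_speed u) (flow_speed u) y by rewrite -(Gamma_step degD).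
rewrite -[k.+1%:R]natr1 in t3 t4 *.
by move: t1 t3 t4 t5; rewrite /e; lra.
Qed.

Section LiYau.
Variables (tau lam : R) (J : nat).
Hypothesis lam0 : 0 <= lam.
Hypothesis hJ : h * J%:R = tau.
Hypothesis tau0 : 0 < tau.
Hypothesis tauD : 12 * D%:R * tau <= 1.

(** The constant of one window: the transport factor of [window_gain]
    divided by the constants of the dimension inequality, summed over a ball of
    radius 2. *)
Definition gain_const : R :=
  2^-1 * (tau / 8) ^+ 2 * tau / (8 * dim_const R D * (D.+1 ^ 2)%:R).

(** Adding [lam] times Gamma multiplies the dissipation of -laplacian by [1 + lam],
    at the price of the additive error [lam * E]. *)
Definition li_yau k x : R :=
  (-1) * laplacian (flow k) x + lam * Gamma (flow k) (flow k) x.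

Let e := lam * (4 * D%:R ^+ 3 * h ^+ 2).

Let e0 : 0 <= e. Proof. by rewrite !mulr_ge0 ?exprn_ge0. Qed.

Lemma dim_const_gt0 : 0 < dim_const R D.
Proof.
case: degD => D0 _; rewrite /dim_const; apply: mulr_gt0.
  by rewrite mulr_gt0 ?ltr0n ?expn_gt0.
by rewrite exprn_gt0 // ltr0n.
Qed.

Lemma gain_const_gt0 : 0 < gain_const.
Proof.
rewrite /gain_const divr_gt0 //.
  by rewrite !mulr_gt0 ?invr_gt0 // exprn_gt0 // divr_gt0.
by apply: mulr_gt0; [rewrite mulr_gt0 ?dim_const_gt0|rewrite ltr0n expn_gt0].
Qed.

Lemma li_yau_step k x : (k < N)%N ->
  li_yau k.+1 x <= tilted h (flow k) (li_yau k) x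
     - 2 * h * (1 + lam) * Gamma2 (flow k) (flow k) x + e.
Proof.
move=> kN; have kN' := ltnW kN.
rewrite /li_yau (tilted_lin degD) /= (laplacian_step degD) (Gamma_step degD).
have : lam * (h ^+ 2 * Gamma (flow_speed (flow k)) (flow_speed (flow k)) x) <= e.
  rewrite /e [4 * _ * _]mulrC ler_wpM2l // ler_wpM2l ?exprn_ge0 //.
  exact: Gamma_flow_speed_le.
lra.
Qed.

(** Let m be the deficit of the functional at [x] below [A] at the end of the window.
    If m < A / 4 then the deficit at [x] was at most twice as large during the whole
    window, so -laplacian stayed above A / 4 there;
      the dimension inequality converts this
    into a gain of order [(1 + lam) * A ^+ 2], which [window_gain] returns to [x]. *)
Lemma li_yau_window n A x : (n + 3 * J <= N)%N -> 0 <= A -> 4 * (lam * E) <= A ->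
  (forall y, li_yau n y <= A) ->
  li_yau (n + 3 * J) x <= A + (3 * J)%:R * e
    - Num.min (A / 4) (gain_const * (1 + lam) * A ^+ 2).
Proof.
move=> nN A0 AE LA.
(* The deficit below A, corrected by the accumulated discretization error. *)
pose P j y := A + j%:R * e - li_yau (n + j) y.
pose Q j y := 2 * (1 + lam) * Gamma2 (flow (n + j)) (flow (n + j)) y.
have P0 y : 0 <= P 0%N y by rewrite /P mul0r addr0 addn0 subr_ge0.
have Q0 j y : (j < 3 * J)%N -> 0 <= Q j y.
  by move=> _; rewrite /Q mulr_ge0 ?Gamma2_ge0 // mulr_ge0 // addr_ge0.
have st j : (j < 3 * J)%N -> (forall y, 0 <= P j y) -> forall y,
    (1 - 2 * D%:R * h) * P j y + h / 2 * \sum_(z <- nbrs y) P j z + h * Q j y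
    <= P j.+1 y.
  move=> jJ Pj y; have jN : (n + j < N)%N by clear -jJ nN; lia.
  have := li_yau_step y jN.
  have := tilted_ge degD h0 (fun z => @flow_slope _ y z (ltnW jN)) Pj.
  have -> : P j.+1 y = A + (j%:R + 1) * e - li_yau (n + j).+1 y
    by rewrite /P addnS natr1.
  rewrite tiltedN /Q; lra.
pose m := P (3 * J)%N x.
(* At least half of the deficit at x survives until the end of the window. *)
have half j : (j <= 3 * J)%N -> P j x <= 2 * m.
  move=> jJ; have := @window_half _ _ D h tau J P Q h0 hJ tauD P0 Q0 st (3 * J - j) j x.
  rewrite subnKC // => /(_ (leqnn _)); rewrite -/m; lra.
have m0 : 0 <= m by have := half 0%N (leq0n _); have := P0 x; lra.
suff : Num.min (A / 4) (gain_const * (1 + lam) * A ^+ 2) <= m by rewrite /m /P; lra.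
rewrite ge_min; have [//|mA] := leP (A / 4) m; apply/orP; right.
have F_ge j : (j < J)%N -> A / 4 <= - laplacian (flow (n + j)) x.
  move=> jJ; have jJ' : (j <= 3 * J)%N by clear -jJ; lia.
  have := half _ jJ'; rewrite /P /li_yau.
  have : lam * Gamma (flow (n + j)) (flow (n + j)) x <= lam * E.
    by rewrite ler_wpM2l //; apply: Gamma_flow_le; clear -jJ nN; lia.
  have : 0 <= j%:R * e by rewrite mulr_ge0.
  lra.
have F2 j : (j < J)%N ->
    A ^+ 2 / 16 <= dim_const R D * \sum_(w <- ball2 x) Gamma2 (flow (n + j))
      (flow (n + j)) w.
  move=> jJ; apply: le_trans (sqr_laplacian_le degD (flow (n + j)) x cd).
  have := F_ge _ jJ; nra.
have gain := @window_gain _ _ D degD h tau J P Q h0 hJ tauD P0 Q0 st x.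
pose kap : R := 2^-1 * (tau / 8) ^+ 2.
have kap0 : 0 <= kap by rewrite mulr_ge0 ?invr_ge0 // exprn_ge0 // divr_ge0 // ltW.
have s1 : kap * (h * \sum_(j < J) \sum_(w <- ball2 x) Q j w) <= (D.+1 ^ 2)%:R * m.
  rewrite exchange_big /= !mulr_sumr.
  apply: (@le_trans _ _ (\sum_(w <- ball2 x) m)).
    rewrite big_seq [leRHS]big_seq; apply: ler_sum => w /gain; exact.
  rewrite big_const_seq count_predT iter_addr_0 -[leLHS]mulr_natl.
  by rewrite ler_wpM2r // ler_nat size_ball2.
have C0 := dim_const_gt0.
have s2 : J%:R * (2 * (1 + lam) * (A ^+ 2 / 16)) <=
  dim_const R D * \sum_(j < J) \sum_(w <- ball2 x) Q j w.
  rewrite mulr_sumr -[J in J%:R](card_ord J) mulr_natl -sumr_const.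
  apply: ler_sum => j _; rewrite /Q -mulr_sumr [leRHS]mulrCA ler_wpM2l ?F2 //.
  by rewrite mulr_ge0 // addr_ge0.
have s3 : kap * (h * (J%:R * (2 * (1 + lam) * (A ^+ 2 / 16)))) <=
   dim_const R D * ((D.+1 ^ 2)%:R * m).
  apply: le_trans (_ : dim_const R D * (kap * (h * \sum_(j < J) \sum_(w <- ball2 x) Q j w)) <= _).
    have -> : dim_const R D * (kap * (h * \sum_(j < J) \sum_(w <- ball2 x) Q j w)) =
      kap * (h * (dim_const R D * \sum_(j < J) \sum_(w <- ball2 x) Q j w)) by ring.
    by rewrite ler_wpM2l // ler_wpM2l.
  by rewrite ler_wpM2l // ltW.
rewrite (mulrA h) hJ mulrA in s3.
have S0 : 0 < (D.+1 ^ 2)%:R :> R by rewrite ltr0n expn_gt0.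
have -> : gain_const * (1 + lam) * A ^+ 2 =
   kap * (tau * (2 * (1 + lam) * (A ^+ 2 / 16))) / (dim_const R D * (D.+1 ^ 2)%:R).
  rewrite /gain_const -/kap; field.
  by rewrite !gt_eqF // ?mulr_gt0.
rewrite ler_pdivrMr; last exact: mulr_gt0.
by move: s3; lra.
Qed.

(** Solves the recursion A |-> A - c A^2 of [li_yau_window], whose solutions decay like
    the inverse of the number of windows.  The shift 8 keeps A / 4 from being
    the smaller term of the minimum in the first windows. *)
Lemma li_yau_decay (K : R) I : (3 * J * I <= N)%N -> 0 <= E -> 0 < K ->
  2 <= gain_const * (1 + lam) * K ->
  (3 * J)%:R * e <= K / (I%:R + 9) ^+ 2 ->
  (forall x, li_yau 0 x <= K / 8) ->
  forall i x, (i <= I)%N -> li_yau (3 * J * i) x <= 4 * (lam * E) + K / (i%:R + 8).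
Proof.
move=> IN E0 K0 gK eK L0; elim=> [|i IH] x iI.
  rewrite muln0 add0r; apply: le_trans (L0 x) _; rewrite lerDr.
  by rewrite mulr_ge0 // mulr_ge0.
have b0 : 0 <= lam * E by rewrite mulr_ge0.
have i0 : 0 <= i%:R :> R by rewrite ler0n.
have K8 : 0 < K / (i%:R + 8) by rewrite divr_gt0 // ltr_wpDl.
pose A := 4 * (lam * E) + K / (i%:R + 8).
have -> : (3 * J * i.+1 = 3 * J * i + 3 * J)%N by rewrite mulnS addnC.
apply: le_trans (@li_yau_window (3 * J * i) A x _ _ _ (fun y => IH y (ltnW iI))) _.
- by rewrite addnC -mulnS; apply: leq_trans IN; rewrite leq_mul2l iI orbT.
- by rewrite /A; lra.
- by rewrite /A; lra.
have iI1 : i%:R + 1 <= I%:R :> R by rewrite natr1 ler_nat.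
have d1 : (3 * J)%:R * e <= K / ((i%:R + 8) * (i%:R + 9)).
  apply: le_trans eK _; rewrite ler_pM2l // lef_pV2 ?posrE.
  - by rewrite expr2; apply: ler_pM; lra.
  - by rewrite exprn_gt0 //; lra.
  - by rewrite mulr_gt0; lra.
(* The gain is twice the required decrease, so one half of it is left for the
   discretization error d1. *)
have d2 : 2 * (K / ((i%:R + 8) * (i%:R + 9))) <= Num.min (A / 4)
  (gain_const * (1 + lam) * A ^+ 2).
  have AK : K / (i%:R + 8) <= A by rewrite /A; lra.
  rewrite le_min; apply/andP; split.
    apply: (@le_trans _ _ (K / (i%:R + 8) / 4)); last by lra.
    have -> : 2 * (K / ((i%:R + 8) * (i%:R + 9))) = K / (i%:R + 8) * (2 / (i%:R + 9)).
      by field; rewrite !gt_eqF //; lra.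
    rewrite ler_pM2l // ler_pdivrMr; lra.
  apply: (@le_trans _ _ (gain_const * (1 + lam) * (K / (i%:R + 8)) ^+ 2)); last first.
    rewrite ler_wpM2l //; first by rewrite mulr_ge0 ?addr_ge0 // ltW // gain_const_gt0.
    by rewrite ler_pXn2r // nnegrE; lra.
  have -> : gain_const * (1 + lam) * (K / (i%:R + 8)) ^+ 2 =
    (gain_const * (1 + lam) * K) * (K / (i%:R + 8) ^+ 2).
    by field; rewrite gt_eqF //; lra.
  apply: ler_pM => //.
    by rewrite divr_ge0 ?mulr_ge0 //; lra.
  rewrite ler_pM2l // lef_pV2 ?posrE.
  - by rewrite expr2; apply: ler_wpM2l; lra.
  - by rewrite mulr_gt0; lra.
  - by rewrite exprn_gt0 //; lra.
have -> : K / (i.+1%:R + 8) = K / (i%:R + 8) - K / ((i%:R + 8) * (i%:R + 9)).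
  by rewrite -[i.+1%:R]natr1; field; rewrite !gt_eqF //; lra.
by move: d1 d2; rewrite /A; lra.
Qed.

End LiYau.

(** An upper bound for -laplacian persists, so it suffices to control it at
    the beginning of each window. *)
Lemma flow_laplacian_le n k (a : R) x : (n + k <= N)%N ->
  (forall y, - laplacian (flow n) y <= a) -> - laplacian (flow (n + k)) x <= a.
Proof.
move=> + na; elim: k x => [|k IH] x nkN; first by rewrite addn0.
rewrite addnS /= (laplacian_step degD).
have nkN' : (n + k <= N)%N by rewrite addnS in nkN; exact: ltnW.
have -> (t : R) : - (t + 2 * h * Gamma2 (flow (n + k)) (flow (n + k)) x) =
   0 - t - 2 * h * Gamma2 (flow (n + k)) (flow (n + k)) x by ring.
rewrite -tiltedN; apply: (@le_trans _ _ (tilted h (flow (n + k))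
   (fun y => 0 - laplacian (flow (n + k)) y) x)).
  by rewrite lerBlDr lerDl; apply: mulr_ge0 => //; exact: mulr_ge0.
apply: (tilted_le degD) => // [y|y]; first exact: flow_slope.
by rewrite sub0r; exact: IH.
Qed.

Lemma flow_loss_window n k (a : R) x : (n + k <= N)%N ->
  (forall y, - laplacian (flow n) y <= a) ->
  flow n x - k%:R * h * a <= flow (n + k) x.
Proof.
move=> + na; elim: k => [|k IH] nkN; first by rewrite !mul0r subr0 addn0.
have nkN' : (n + k <= N)%N by rewrite addnS in nkN; exact: ltnW.
have := IH nkN'; have := flow_laplacian_le x nkN' na.
rewrite addnS /= /flow_step /flow_speed -[k.+1%:R]natr1.
have := Gamma_ge0 degD (flow (n + k)) x.
set g := Gamma _ _ _; set l := laplacian _ _; set v := flow (n + k) x.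
move=> g0 la.
have : h * (- l) <= h * a by rewrite ler_wpM2l.
have : 0 <= h * g by rewrite mulr_ge0.
lra.
Qed.

Lemma flow_loss L (a : nat -> R) I x : (L * I <= N)%N ->
  (forall i y, (i < I)%N -> - laplacian (flow (L * i)) y <= a i) ->
  u0 x - L%:R * h * \sum_(i < I) a i <= flow (L * I) x.
Proof.
elim: I => [|I IH] IN aI; first by rewrite muln0 big_ord0 mulr0 subr0.
have h1 : u0 x - L%:R * h * \sum_(i < I) a i <= flow (L * I) x.
  apply: IH => [|i y iI]; first by apply: leq_trans IN; rewrite leq_mul2l leqnSn orbT.
  by apply: aI; exact: ltnW.
have := @flow_loss_window (L * I) L (a I) x; rewrite addnC -mulnS => /(_ IN).
move=> /(_ (fun y => aI _ y (ltnSn I))) h2; rewrite big_ord_recr /=.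
by move: h1 h2; lra.
Qed.

End Flow.

(** * Elementary inequalities *)

Section Exp.
Import numFieldNormedType.Exports.
Variable R : realType.

Lemma expR_le_inv (x : R) : x < 1 -> expR x <= (1 - x)^-1.
Proof.
move=> x1; rewrite -[x in expR x]opprK expRN lef_pV2 ?posrE ?expR_gt0 //.
  exact: expR_ge1Dx.
by rewrite subr_gt0.
Qed.

Lemma expR_le_quad (x : R) : x <= 2^-1 -> expR x <= 1 + x + 2 * x ^+ 2.
Proof.
move=> x2; have x1 : 0 < 1 - x by lra.
apply: le_trans (expR_le_inv _) _; first by lra.
rewrite -[leLHS]mul1r ler_pdivrMr //.
have -> : (1 + x + 2 * x ^+ 2) * (1 - x) = 1 + (1 - 2 * x) * x ^+ 2 by ring.
by rewrite lerDl mulr_ge0 ?sqr_ge0 //; lra.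
Qed.

(** The second order Taylor polynomial appears in the flow, since the speed is
    the sum of d + d^2 / 2 over the slopes d;
      the cubic error is what makes the comparison with the
    linear heat flow work at large scales. *)
Lemma expR_ge_cubic (x : R) : 1 + x + x ^+ 2 / 2 - `|x| ^+ 3 <= expR x.
Proof.
have [x0|x0] := leP 0 x.
  pose f (y : R) := expR y - (1 + y + y ^+ 2 / 2).
  pose df (y : R) := expR y - (1 + y).
  have fd (y : R) : is_derive y 1 f (df y).
    rewrite /f; apply: is_derive_eq.
    by rewrite /df /GRing.scale /=; field.
  have [c _] : exists2 c, c \in `[0, x] & f x - f 0 = df c * (x - 0).
    apply: MVT_segment => //.
    by apply: derivable_within_continuous => y _;
      exact: (@ex_derive _ _ _ _ _ _ _ (fd y)).
  have : 0 <= df c by rewrite subr_ge0 expR_ge1Dx.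
  have : 0 <= `|x| ^+ 3 by rewrite exprn_ge0.
  rewrite /f expR0 => h1 h2 h3; have : 0 <= df c * (x - 0) by rewrite mulr_ge0 // subr0.
  by rewrite -h3; lra.
pose f (y : R) := expR y - (1 + y + y ^+ 2 / 2 + y ^+ 3).
pose df (y : R) := expR y - (1 + y + 3 * y ^+ 2).
have fd (y : R) : is_derive y 1 f (df y).
  rewrite /f; apply: is_derive_eq.
  by rewrite /df /GRing.scale /=; field.
have [c] : exists2 c, c \in `[x, 0] & f 0 - f x = df c * (0 - x).
  apply: MVT_segment; first exact: ltW.
  by apply: derivable_within_continuous => y _;
    exact: (@ex_derive _ _ _ _ _ _ _ (fd y)).
rewrite in_itv /= => /andP[_ c0].
have : df c <= 0.
  rewrite subr_le0; apply: le_trans (expR_le_inv _) _; first by lra.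
  rewrite -[leLHS]mul1r ler_pdivrMr; last by lra.
  have -> : (1 + c + 3 * c ^+ 2) * (1 - c) = 1 + (2 - 3 * c) * c ^+ 2 by ring.
  by rewrite lerDl mulr_ge0 ?sqr_ge0 //; lra.
rewrite ltr0_norm // /f expR0 => h1 h3.
have : df c * (0 - x) <= 0 by rewrite mulr_le0_ge0 //; lra.
rewrite -h3; lra.
Qed.

Lemma sum_invsqrt_le n : \sum_(i < n) (Num.sqrt (i%:R + 8 : R))^-1 <= 2 * Num.sqrt n%:R.
Proof.
elim: n => [|n IH]; first by rewrite big_ord0 sqrtr0 mulr0.
rewrite big_ord_recr /=.
have n0 : 0 <= n%:R :> R by rewrite ler0n.
set a : R := Num.sqrt n%:R in IH *; set b : R := Num.sqrt n.+1%:R.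
have a2 : a ^+ 2 = n%:R by rewrite sqr_sqrtr.
have b2 : b ^+ 2 = n%:R + 1 by rewrite sqr_sqrtr // natr1.
have a0 : 0 <= a by rewrite sqrtr_ge0.
have b0 : 0 < b by rewrite sqrtr_gt0 ltr0n.
have : (Num.sqrt (n%:R + 8 : R))^-1 <= b^-1.
  by rewrite lef_pV2 ?posrE ?sqrtr_gt0 ?ler_wsqrtr //; first rewrite -natr1; lra.
have : b^-1 <= 2 * (b - a).
  rewrite -[leLHS]mul1r ler_pdivrMr //.
  have ab : a <= b by rewrite ler_wsqrtr // ler_nat.
  nra.
lra.
Qed.

End Exp.


(** * Comparison with the linear heat semigroup *)

Section Heat.
Variables (R : realType) (G : sgraph) (D : nat).
Hypothesis degD : degree_bound G D.
Implicit Types (x y z w : G) (f g u : G -> R).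

Definition heat_step (h : R) f x : R := f x + h * laplacian f x.

Variable h : R.
Hypothesis h0 : 0 <= h.
Hypothesis hD : 2 * D%:R * h <= 1.

Lemma heat_stepDc f (c : R) x : heat_step h (fun y => f y + c) x = heat_step h f x + c.
Proof.
rewrite /heat_step addrAC; congr (_ + _ * _ + _); rewrite !(laplacianE degD).
by apply: eq_bigr => y _; ring.
Qed.

Lemma heat_stepZ (a : R) f x : heat_step h (fun y => a * f y) x = a * heat_step h f x.
Proof. by rewrite /heat_step (laplacianZ degD); ring. Qed.

Lemma heat_step_ge0 f x : (forall y, 0 <= f y) -> 0 <= heat_step h f x.
Proof.
move=> f0; rewrite /heat_step.
have : - laplacian f x <= D%:R * f x.
  rewrite (laplacianE degD) -sumrN; apply: (sum_nbrs_le degD) => // y _.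
  by have := f0 y; lra.
have := f0 x; move: (f x) (laplacian f x) => a l a0 la.
have : h * (- l) <= h * (D%:R * a) by rewrite ler_wpM2l.
have Dh : 0 <= D%:R * h by rewrite mulr_ge0.
have : (D%:R * h) * a <= 1 * a by apply: ler_wpM2r => //; move: hD; lra.
lra.
Qed.

Lemma heat_step_le f g x : (forall y, f y <= g y) -> heat_step h f x <= heat_step h g x.
Proof.
move=> fg; have : 0 <= heat_step h (fun y => g y + -1 * f y) x.
  by apply: heat_step_ge0 => y; have := fg y; lra.
by rewrite /heat_step (laplacianD degD) (laplacianZ degD); lra.
Qed.

(** The heat step is symmetric, so it can be moved to the indicator of [S],
    where it is bounded by 1.  Stating the bound for all finite sums avoids
    summation over the possibly infinite vertex set. *)
Lemma sum_heat_step (S : seq G) f (c : R) : uniq S -> (forall y, 0 <= f y) ->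
  (forall T : seq G, uniq T -> \sum_(y <- T) f y <= c) ->
  \sum_(y <- S) heat_step h f y <= c.
Proof.
move=> uS f0 fc.
(* T contains S and its neighbours: summation by parts for the indicator q of S
   has no boundary terms in T. *)
pose T := undup (S ++ flatten [seq nbrs y | y <- S]).
have uT : uniq T by exact: undup_uniq.
pose q y : R := (y \in S)%:R.
have ST y : y \in S -> y \in T by move=> yS; rewrite mem_undup mem_cat yS.
have qT w : q w != 0 -> inner_vertex T w.
  rewrite /q; case: (boolP (w \in S)) => [wS _|_]; last by rewrite eqxx.
  split=> [|y yw]; first exact: ST.
  by rewrite mem_undup mem_cat; apply/orP; right; apply/flattenP;
    exists (nbrs w) => //; exact: map_f.
have -> : \sum_(y <- S) heat_step h f y = \sum_(y <- T) q y * heat_step h f y.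
  rewrite [RHS](bigID (mem S)) /= [X in _ + X]big1 ?addr0; last first.
    by move=> y /negbTE yS; rewrite /q yS mul0r.
  rewrite -[RHS]big_filter (eq_big_seq (fun y => q y * heat_step h f y)).
    apply: perm_big; apply: uniq_perm; rewrite ?filter_uniq // => y.
    by rewrite mem_filter andb_idr //; exact: ST.
  by move=> y yS; rewrite /q yS mul1r.
have -> : \sum_(y <- T) q y * heat_step h f y = \sum_(y <- T) heat_step h q y * f y.
  rewrite /heat_step; under eq_bigr do rewrite mulrDr mulrCA.
  under [RHS]eq_bigr do rewrite mulrDl -mulrA.
  by rewrite !big_split /= -!mulr_sumr (sum_laplacianC degD).
apply: le_trans (fc T uT); apply: ler_sum => y _; rewrite ler_piMl //.
have -> : 1 = heat_step h (fun=> 1) y.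
  by rewrite /heat_step (laplacianE degD) big1 ?mulr0 ?addr0 // => z _; rewrite subrr.
by apply: heat_step_le => z; rewrite /q; case: (z \in S).
Qed.

Variables (E s : R) (u0 f0 : G -> R) (N : nat) (c : R).
Hypothesis cd : CD0oo R G.
Hypothesis E8 : E <= 8^-1.
Hypothesis Es : 2 * E <= s ^+ 2.
Hypothesis s0 : 0 <= s.
Hypothesis u0E : forall x, Gamma u0 u0 x <= E / 2.
Hypothesis NE : N%:R * (4 * D%:R ^+ 3 * h ^+ 2) <= E / 2.

(** Growth rate, per unit of time, of the ratio between exp of the flow and the linear
    heat flow: the cubic Taylor error and the error of the time step. *)
Definition cubic_rate : R := 4 * (D%:R * s ^+ 3 + 2 * h * D%:R ^+ 2).

(** Up to the factor [1 + h * cubic_rate], exp of the flow is a subsolution of the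
    linear heat equation: the speed is the sum of d + d^2 / 2 over the slopes d,
    which agrees with that of exp d - 1 to second order. *)
Lemma exp_flow_step k x : (k < N)%N ->
  expR (flow h u0 k.+1 x) <=
  (1 + h * cubic_rate) * heat_step h (fun y => expR (flow h u0 k y)) x.
Proof.
move=> kN; pose u := flow h u0 k.
have D1 : 1 <= D%:R :> R := degree_bound_ge1 R degD.
have uE y : Gamma u u y <= E by apply: (Gamma_flow_le degD cd h0 hD E8 u0E NE);
  exact: ltnW.
have sl y : y \in nbrs x -> `|u y - u x| <= 2^-1 by exact: (slope_le_half degD E8 uE).
have sls y : y \in nbrs x -> `|u y - u x| <= s by exact: (slope_of_Gamma degD uE s0 Es).
pose v := flow_speed u x.
have vE : v = \sum_(y <- nbrs x) ((u y - u x) + (u y - u x) ^+ 2 / 2).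
  rewrite /v /flow_speed (laplacianE degD) (GammaE degD) mulr_sumr -big_split /=.
  by apply: eq_bigr => y _; field.
have vD : `|v| <= D%:R * 1.
  rewrite vE; apply: (norm_sum_nbrs_le degD) => // y /sl;
    rewrite !ler_norml => /andP[s1 s2].
  by apply/andP; split; nra.
rewrite mulr1 in vD.
pose B := 1 + h * \sum_(y <- nbrs x) (expR (u y - u x) - 1).
have -> : heat_step h (fun y => expR (u y)) x = expR (u x) * B.
  rewrite /heat_step (laplacianE degD) /B mulrDr mulr1 mulrCA; congr (_ + _ * _).
  rewrite mulr_sumr; apply: eq_bigr => y _.
  by rewrite mulrBr mulr1 -expRD; congr (expR _ - _); ring.
have -> : flow h u0 k.+1 x = u x + h * v by [].
rewrite expRD mulrCA ler_wpM2l ?expR_ge0 //.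
have hv : h * `|v| <= h * D%:R by rewrite ler_wpM2l.
have hv2 : (h * v) ^+ 2 <= (h * D%:R) ^+ 2.
  rewrite -real_normK ?num_real // ler_pXn2r ?nnegrE ?mulr_ge0 //.
  by rewrite normrM (ger0_norm h0).
have hDge : 0 <= h * D%:R by rewrite mulr_ge0.
have hvn : `|h * v| <= 2^-1.
  by rewrite normrM (ger0_norm h0); apply: le_trans hv _; move: hD; lra.
move: (hvn); rewrite ler_norml => /andP[hvl hvr].
have e1 : expR (h * v) <= 1 + h * v + 2 * (h * D%:R) ^+ 2.
  by apply: le_trans (expR_le_quad hvr) _; lra.
(* The bound s serves for the error, the bound 1/2 keeps B away from 0. *)
pose t := Num.min s 2^-1.
have t0 : 0 <= t by rewrite le_min s0 invr_ge0 ler0n.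
have t3 : t ^+ 3 <= s ^+ 3 by rewrite ler_pXn2r ?nnegrE // ge_min lexx.
have t8 : t ^+ 3 <= 2^-1 ^+ 3
  by rewrite ler_pXn2r ?nnegrE ?invr_ge0 // ge_min lexx orbT.
have e2 : h * v - h * (D%:R * t ^+ 3) <= B - 1.
  rewrite /B [1 + _]addrC addrK -mulrBr ler_wpM2l // lerBlDr vE.
  rewrite -lerBlDl -sumrB; apply: (sum_nbrs_le degD); first exact: exprn_ge0.
  move=> y yx; have := expR_ge_cubic (u y - u x).
  have : `|u y - u x| ^+ 3 <= t ^+ 3.
    by rewrite ler_pXn2r ?nnegrE // le_min sls // sl.
  lra.
have hDt : h * (D%:R * t ^+ 3) <= h * (D%:R * s ^+ 3) by rewrite !ler_wpM2l.
have hDt8 : (h * D%:R) * t ^+ 3 <= 2^-1 * 2^-1 ^+ 3.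
  by apply: ler_pM => //; [exact: exprn_ge0|move: hD; lra].
have B4 : 4^-1 <= B by move: hvl e2 hDt8; lra.
have r0 : 0 <= h * (D%:R * s ^+ 3 + 2 * h * D%:R ^+ 2).
  by rewrite !(mulr_ge0, addr_ge0, exprn_ge0).
rewrite mulrDl mul1r /cubic_rate.
set r := h * (D%:R * s ^+ 3 + 2 * h * D%:R ^+ 2) in r0.
have -> : h * (4 * (D%:R * s ^+ 3 + 2 * h * D%:R ^+ 2)) * B = 4 * r * B
  by rewrite /r; ring.
have : r <= 4 * r * B by nra.
by rewrite /r; move: e1 e2 hDt; lra.
Qed.

Lemma exp_flow_le k x : (k <= N)%N -> 0 <= c -> (forall y, 0 <= f0 y) ->
  (forall y, expR (u0 y) <= f0 y + c) ->
  expR (flow h u0 k x) <= (1 + h * cubic_rate) ^+ k * (iter k (heat_step h) f0 x + c).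
Proof.
move=> + c0 f00 fc; have r0 : 0 <= 1 + h * cubic_rate.
  by rewrite /cubic_rate !(mulr_ge0, addr_ge0, exprn_ge0).
elim: k x => [|k IH] x kN; first by rewrite expr0 mul1r; exact: fc.
apply: le_trans (exp_flow_step x kN) _.
rewrite exprS -mulrA ler_wpM2l //.
apply: le_trans (heat_step_le x (fun y => IH y (ltnW kN))) _.
rewrite /= -heat_stepDc heat_stepZ; exact: lexx.
Qed.

Lemma heat_ge0 k x : (forall y, 0 <= f0 y) -> 0 <= iter k (heat_step h) f0 x.
Proof. by move=> f00; elim: k x => [|k IH] x //=; exact: heat_step_ge0. Qed.

Lemma sum_heat k (S : seq G) (b : R) : uniq S -> (forall y, 0 <= f0 y) ->
  (forall T : seq G, uniq T -> \sum_(y <- T) f0 y <= b) ->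
  \sum_(y <- S) iter k (heat_step h) f0 y <= b.
Proof.
move=> uS f00 fb; elim: k S uS => [|k IH] S uS /=; first exact: fb.
by apply: sum_heat_step => // y; exact: heat_ge0.
Qed.

End Heat.

(** * Doubling at large scales *)

Section Cutoff.
Variables (R : realType) (G : sgraph) (D : nat).
Hypothesis degD : degree_bound G D.
Implicit Types (x y z w : G).

Lemma cball_mono m n x : (m <= n)%N -> {subset cball m x <= cball n x}.
Proof.
move=> /subnKC <-; elim: (n - m)%N => [|k IH] y ym; first by rewrite addn0.
by rewrite addnS; apply: cballS (IH y ym) _; left.
Qed.

(** The distance from [x] to [y] truncated at [r]. *)
Definition layer r x y : nat := \sum_(k < r) (y \notin cball k x).

Lemma layer_center r x : layer r x x = 0%N.
Proof. by rewrite /layer big1 // => k _; rewrite cball_center. Qed.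

Lemma layer_le r x y : (layer r x y <= r)%N.
Proof.
rewrite /layer -[leqRHS]card_ord -sum1_card; apply: leq_sum => k _.
by case: (_ \notin _).
Qed.

Lemma layer_out r x y : y \notin cball r x -> layer r.+1 x y = r.+1.
Proof.
move=> yr; rewrite /layer -[RHS]card_ord -sum1_card; apply: eq_bigr => k _.
have -> // : y \notin cball k x.
by apply: contra yr; apply: cball_mono; rewrite -ltnS.
Qed.

Lemma layer_nbr r x y z : y \in nbrs z -> (layer r x z <= (layer r x y).+1)%N.
Proof.
move=> yz; case: r => [|r]; first by rewrite /layer big_ord0.
rewrite /layer big_ord_recl big_ord_recr /= -[leqRHS]add1n leq_add //.
  by case: (_ \notin _).
apply: leq_trans (leq_addr _ _); apply: leq_sum => k _.
have [yk|] := boolP (y \in cball k x); last by case: (_ \notin _).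
suff -> : z \in cball k.+1 x by [].
by apply: cballS yk _; right; rewrite (nbrs_sym degD).
Qed.

Definition cutoff (eps : R) r x y : R := - (eps * (layer r x y)%:R).

Lemma cutoff_slope (eps : R) r x y z : 0 <= eps -> y \in nbrs z ->
  `|cutoff eps r x y - cutoff eps r x z| <= eps.
Proof.
move=> e0 yz; have zy : z \in nbrs y by rewrite (nbrs_sym degD).
have h1 : (layer r x z)%:R <= (layer r x y)%:R + 1 :> R
  by rewrite natr1 ler_nat layer_nbr.
have h2 : (layer r x y)%:R <= (layer r x z)%:R + 1 :> R
  by rewrite natr1 ler_nat layer_nbr.
by rewrite /cutoff ler_norml; apply/andP; split; nra.
Qed.

Lemma cball_slope (u : G -> R) (s : R) n x y :
  (forall z w, w \in nbrs z -> `|u w - u z| <= s) -> 0 <= s ->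
  y \in cball n x -> u x - n%:R * s <= u y.
Proof.
move=> us s0; elim: n y => [|n IH] y.
  by rewrite inE => /eqP ->; rewrite mul0r subr0.
move=> /cballSP[w /IH wn [->|yw]]; rewrite -[n.+1%:R]natr1; first by lra.
have := us _ _ yw; rewrite ler_norml => /andP[h _]; lra.
Qed.

End Cutoff.

Section Constants.
Variables (R : realType) (D : nat).
(** The largest length allowed for a third of a window. *)
Definition time_unit : R := (12 * D%:R)^-1.
(** The first summand makes the recursion of [li_yau_decay] contract, the second
    one dominates the initial datum. *)
Definition decay_const : R := 2 / gain_const D time_unit + 64 * D%:R.
Definition loss_const : R := 8 * D%:R + decay_const.
(** The initial height M, of order p^2 D: the slopes at the final time, of order
    sqrt (D M) p / r, then cost at most M / 8 over a distance 2r. *)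
Definition height (p : nat) : nat := ((128 * p) ^ 2 * D)%N.
(** From this radius on, the cubic errors, of order (D M)^3 / r, are below 1, and
    the number of windows is positive. *)
Definition large_radius (p : nat) : nat := (16 * (D * height p) ^ 3 + p)%N.
End Constants.

(** The flow runs for [q ^ 2] windows with [q = r %/ p], that is, up to a time of order
    (r / p)^2 / D; the parameter [p], which depends on [D] only, makes the loss of
    height small.  The number [J] of steps in a third of a window is chosen last, and
    [hsmall] is the smallness of the step that all discretization errors require. *)
Section Doubling.
Variables (R : realType) (G : sgraph) (D : nat).
Hypothesis degD : degree_bound G D.
Hypothesis cd : CD0oo R G.
Variables (p r : nat) (x : G).
Hypothesis hp : 8 * loss_const R D <= p%:R.
Hypothesis hr : (large_radius D p <= r)%N.

Let M := height D p.
Let q := (r %/ p)%N.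
Let eps : R := M%:R / r%:R.
Let tau := time_unit R D.

Let D0 : (0 < D)%N. Proof. by case: degD. Qed.
Let D1 : 1 <= D%:R :> R. Proof. by rewrite ler1n. Qed.

Let tau0 : 0 < tau. Proof. by rewrite invr_gt0 mulr_gt0 // ltr0n. Qed.

Let tauE : 12 * D%:R * tau = 1.
Proof. by rewrite /tau /time_unit mulfV // mulf_neq0 // pnatr_eq0 -lt0n. Qed.

Let tauD : 12 * D%:R * tau <= 1. Proof. by rewrite tauE. Qed.

Let gain0 : 0 < gain_const D tau. Proof. exact: (gain_const_gt0 degD). Qed.

Let C4ge : 64 * D%:R <= decay_const R D.
Proof. by rewrite /decay_const lerDr divr_ge0 // ltW. Qed.

Let p0 : (0 < p)%N.
Proof. by rewrite -(ltr0n R); move: hp C4ge D1; rewrite /loss_const; lra. Qed.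

Let M0 : (0 < M)%N. Proof. by rewrite /M /height muln_gt0 D0 expn_gt0 muln_gt0 p0. Qed.

Let DM_le : (4 * (D * M) <= r)%N.
Proof.
apply: leq_trans hr; rewrite /large_radius -/M.
have DM0 : (0 < D * M)%N by rewrite muln_gt0 D0.
have : (D * M <= (D * M) ^ 3)%N by rewrite -[leqLHS]expn1 leq_pexp2l.
by clear; lia.
Qed.

Let DM3_le : (16 * (D * M) ^ 3 <= r)%N.
Proof. by apply: leq_trans hr; rewrite /large_radius leq_addr. Qed.

Let r0 : (0 < r)%N.
Proof. by apply: leq_trans DM_le; rewrite muln_gt0 muln_gt0 D0. Qed.

Let rr0 : 0 < r%:R :> R. Proof. by rewrite ltr0n. Qed.

Let q0 : (0 < q)%N.
Proof. by rewrite divn_gt0 //; apply: leq_trans hr; rewrite /large_radius leq_addl. Qed.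

Let qp : (q * p <= r)%N. Proof. exact: leq_divM. Qed.

Let rpq : (r <= 2 * p * q)%N.
Proof.
have := ltn_ceil r p0; rewrite -/q; move: q0 p0; clear; nia.
Qed.

Let qr : (q <= r)%N. Proof. exact: leq_div. Qed.

Let eps0 : 0 < eps. Proof. by rewrite divr_gt0 // ltr0n. Qed.

Let epsD : 4 * D%:R * eps <= 1.
Proof.
rewrite /eps mulrA ler_pdivrMr // mul1r -!natrM ler_nat -mulnA; exact: DM_le.
Qed.

Let eps1 : eps <= 4^-1.
Proof. by have := epsD; have := eps0; have := D1; nra. Qed.

Let Q : R := (q ^ 2)%:R.

Let Q1 : 1 <= Q. Proof. by rewrite ler1n expn_gt0 q0. Qed.

Variable J : nat.
Hypothesis J0 : (0 < J)%N.
Let h := tau / J%:R.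
Hypothesis hsmall : h * D%:R * (Q + 9) ^+ 2 <= eps ^+ 2.

Let h0 : 0 < h. Proof. by rewrite divr_gt0 // ltr0n. Qed.

Let hJ : h * J%:R = tau.
Proof. by rewrite /h divfK // pnatr_eq0 -lt0n. Qed.

Let N := (3 * J * q ^ 2)%N.

Let Jh : (3 * J)%:R * h = (4 * D%:R)^-1.
Proof.
have J1 : J%:R != 0 :> R by rewrite pnatr_eq0 -lt0n.
have D2 : D%:R != 0 :> R by rewrite pnatr_eq0 -lt0n.
by rewrite natrM /h /tau /time_unit; field; rewrite J1 D2.
Qed.

Let Nh : N%:R * h = Q / (4 * D%:R).
Proof. by rewrite /N natrM mulrAC Jh mulrC. Qed.

Let w := h * D%:R.
Let w0 : 0 <= w. Proof. by rewrite mulr_ge0 // ltW. Qed.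

Let wQ : w * Q <= eps ^+ 2.
Proof.
apply: le_trans hsmall; rewrite -/w ler_wpM2l //.
by have := Q1; nra.
Qed.

Let eps2 : eps ^+ 2 <= 16^-1.
Proof. have := eps1; have := eps0; nra. Qed.

Let hD : 2 * D%:R * h <= 1.
Proof.
have -> : 2 * D%:R * h = 2 * w by rewrite /w; ring.
have : w <= w * Q by rewrite ler_peMr.
by have := wQ; have := eps2; lra.
Qed.

Let E := 2 * D%:R * eps ^+ 2.
Let E0 : 0 <= E. Proof. by rewrite !mulr_ge0 // ?sqr_ge0. Qed.

Let E8 : E <= 8^-1.
Proof. by rewrite /E; have := epsD; have := eps1; have := eps0; nra. Qed.

Let u0 := cutoff eps r x.

Let u0s y z : y \in nbrs z -> `|u0 y - u0 z| <= eps.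
Proof. by apply: (cutoff_slope degD); exact: ltW. Qed.

Let u0E y : Gamma u0 u0 y <= E / 2.
Proof.
have -> : E / 2 = D%:R * (eps * eps) by rewrite /E; field.
apply: le_trans (ler_norm _) _.
by apply: (Gamma_le_slope degD) => [||z zy|z zy];
  [exact: ltW|exact: ltW|exact: u0s|exact: u0s].
Qed.

Let NE : N%:R * (4 * D%:R ^+ 3 * h ^+ 2) <= E / 2.
Proof.
have -> : N%:R * (4 * D%:R ^+ 3 * h ^+ 2) = D%:R * (w * Q).
  have -> : N%:R * (4 * D%:R ^+ 3 * h ^+ 2) = (N%:R * h) * (4 * D%:R ^+ 3 * h) by ring.
  have D2 : D%:R != 0 :> R by rewrite pnatr_eq0 -lt0n.
  by rewrite Nh /w; field; rewrite D2.
have -> : E / 2 = D%:R * eps ^+ 2 by rewrite /E; field.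
by rewrite ler_wpM2l.
Qed.

Let u := flow h u0.

Let C4 := decay_const R D.
Let C5 := loss_const R D.

(** [li_yau_decay] bounds -laplacian by 4 lam E + K / (i + 8), where K is of order
    1 / (1 + lam) and E of order eps^2.  The choice
    lam = 1 / (eps sqrt (i + 8)) balances the two terms. *)
Lemma laplacian_decay i y : (i < q ^ 2)%N ->
  - laplacian (u (3 * J * i)) y <= C5 * eps * (Num.sqrt (i%:R + 8))^-1.
Proof.
move=> iq; set sq := Num.sqrt _.
have i0 : 0 <= i%:R :> R by rewrite ler0n.
have sq2 : sq ^+ 2 = i%:R + 8 by rewrite sqr_sqrtr //; lra.
have sq1 : 1 <= sq.
  by rewrite -(@ler_pXn2r _ 2) ?nnegrE ?sqrtr_ge0 // sq2 expr1n; lra.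
pose lam := (eps * sq)^-1.
have sq0 : 0 < sq by lra.
have lam0 : 0 < lam by rewrite invr_gt0 mulr_gt0.
have lame : lam * eps = sq^-1.
  by rewrite /lam invfM mulrAC mulVf ?mul1r // gt_eqF.
have lame1 : lam * eps <= 1 by rewrite lame invf_le1.
have lame0 : 0 < lam * eps by rewrite mulr_gt0.
have C40 : 0 < C4 by move: C4ge D1; rewrite -/C4; lra.
have l1 : 0 < 1 + lam by lra.
pose K := C4 / (1 + lam).
have K0 : 0 < K by rewrite divr_gt0.
have H1 : 2 <= gain_const D tau * (1 + lam) * K.
  have -> : gain_const D tau * (1 + lam) * K = gain_const D tau * C4.
    by rewrite /K; field; rewrite gt_eqF.
  rewrite /C4 /decay_const -/tau mulrDr mulrCA divff ?gt_eqF // mulr1 lerDl.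
  by apply: mulr_ge0 => //; exact: ltW.
have H2 : (3 * J)%:R * (lam * (4 * D%:R ^+ 3 * h ^+ 2)) <= K / ((q ^ 2)%:R + 9) ^+ 2.
  have -> : (3 * J)%:R * (lam * (4 * D%:R ^+ 3 * h ^+ 2)) =
     ((3 * J)%:R * h) * (lam * (4 * D%:R ^+ 3 * h)) by ring.
  have D2 : D%:R != 0 :> R by rewrite pnatr_eq0 -lt0n.
  rewrite Jh -/Q; have -> : (4 * D%:R)^-1 * (lam * (4 * D%:R ^+ 3 * h)) = lam * D%:R * w.
    by rewrite /w; field; rewrite D2.
  rewrite /K ler_pdivlMr; last by rewrite exprn_gt0 //; move: Q1; lra.
  rewrite ler_pdivlMr //.
  have -> : lam * D%:R * w * (Q + 9) ^+ 2 * (1 + lam) =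
    lam * D%:R * (1 + lam) * (w * (Q + 9) ^+ 2) by ring.
  apply: (@le_trans _ _ (lam * D%:R * (1 + lam) * eps ^+ 2)).
    apply: ler_wpM2l; last exact: hsmall.
    by rewrite mulr_ge0 ?(ltW l1) // mulr_ge0 // ltW.
  have -> : lam * D%:R * (1 + lam) * eps ^+ 2 = D%:R * ((lam * eps) * (eps + lam * eps)) by ring.
  have : (lam * eps) * (eps + lam * eps) <= 1 * 2 by apply: ler_pM; move: eps0 eps1;
    lra.
  by move: C4ge D1; rewrite -/C4; nra.
have H3 y' : li_yau h u0 lam 0 y' <= K / 8.
  rewrite /li_yau /= mulN1r.
  have L1 : - laplacian u0 y' <= D%:R * eps.
    rewrite (laplacianE degD) -sumrN; apply: (sum_nbrs_le degD); first exact: ltW.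
    by move=> z zy; have := u0s zy; rewrite ler_norml => /andP[]; lra.
  have L2 : lam * Gamma u0 u0 y' <= lam * (D%:R * eps ^+ 2).
    by rewrite ler_wpM2l ?(ltW lam0) //; apply: le_trans (u0E y') _; rewrite /E; lra.
  apply: le_trans (lerD L1 L2) _.
  rewrite /K ler_pdivlMr // ler_pdivlMr //.
  have -> : (D%:R * eps + lam * (D%:R * eps ^+ 2)) * 8 * (1 + lam) =
    8 * D%:R * ((1 + lam * eps) * (eps + lam * eps)) by ring.
  have : (1 + lam * eps) * (eps + lam * eps) <= 2 * 2 by apply: ler_pM;
    move: eps0 eps1; lra.
  by move: C4ge D1; rewrite -/C4; nra.
have main := li_yau_decay degD cd (ltW h0) hD E8 u0E NE (ltW lam0) hJ tau0
  tauD (leqnn N) E0 K0 H1 H2 H3 y (ltnW iq).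
have Gp : 0 <= lam * Gamma (u (3 * J * i)) (u (3 * J * i)) y.
  by rewrite mulr_ge0 ?(ltW lam0) //; exact: (Gamma_ge0 degD).
have {}main : - laplacian (u (3 * J * i)) y <= 4 * (lam * E) + K / (i%:R + 8).
  by apply: le_trans main; rewrite /li_yau mulN1r lerDl.
apply: le_trans main _.
have -> : 4 * (lam * E) = 8 * D%:R * eps * sq^-1 by rewrite /E -lame; ring.
have : K / (i%:R + 8) <= C4 * eps * sq^-1.
  have -> : C4 * eps * sq^-1 = C4 * (lam^-1 * (sq ^+ 2)^-1).
    by rewrite /lam; field; rewrite !gt_eqF.
  rewrite /K -sq2 -mulrA ler_wpM2l ?(ltW C40) //.
  by rewrite ler_wpM2r ?invr_ge0 ?sqr_ge0 // lef_pV2 ?posrE //; lra.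
by rewrite /C5 /loss_const -/C4; lra.
Qed.

(** The bounds of [laplacian_decay] add up to a loss of order eps q, hence of order
    M / p, which is at most M / 8 for large [p]. *)
Lemma flow_center : - (M%:R / 8) <= u N x.
Proof.
have := flow_loss degD cd (ltW h0) hD E8 u0E NE x (leqnn N) laplacian_decay.
rewrite -/N -/u Jh -mulr_sumr {1}/u0 /cutoff layer_center mulr0 oppr0 sub0r.
apply: le_trans; rewrite lerN2.
have C50 : 0 < C5 by rewrite /C5 /loss_const; move: C4ge D1; lra.
have := sum_invsqrt_le R (q ^ 2).
have -> : Num.sqrt (q ^ 2)%:R = q%:R :> R by rewrite natrX sqrtr_sqr ger0_norm.
move=> s2.
have Di : (4 * D%:R)^-1 <= 4^-1 :> R by rewrite lef_pV2 ?posrE //; move: D1; lra.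
have ce0 : 0 <= C5 * eps by rewrite mulr_ge0 // ltW.
set S := \sum_(i < q ^ 2) _ in s2 *.
have S0 : 0 <= S by rewrite sumr_ge0 // => i _; rewrite invr_ge0 sqrtr_ge0.
apply: (@le_trans _ _ (4^-1 * (C5 * eps * (2 * q%:R)))).
  by apply: ler_pM; [rewrite invr_ge0 mulr_ge0|exact: mulr_ge0|exact: Di|exact: ler_wpM2l].
have e1 : eps * q%:R * p%:R <= M%:R.
  rewrite /eps mulrAC -mulrA mulrAC ler_pdivrMr // ler_wpM2l //.
  by rewrite mulrC -natrM ler_nat.
have : C5 * (eps * q%:R) * 8 <= eps * q%:R * p%:R.
  have -> : C5 * (eps * q%:R) * 8 = eps * q%:R * (8 * C5) by ring.
  by rewrite ler_wpM2l // mulr_ge0 // ltW.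
have : 0 <= C5 * (eps * q%:R) by rewrite !mulr_ge0 // ltW.
by lra.
Qed.

Let u0_le0 y : u0 y <= 0.
Proof. by rewrite /u0 /cutoff oppr_le0 mulr_ge0 // ltW. Qed.

Let u0_ge y : - M%:R <= u0 y.
Proof.
rewrite /u0 /cutoff lerN2 /eps mulrAC ler_pdivrMr // ler_wpM2l // ler_nat.
exact: layer_le.
Qed.

Let sig : R := 512 * p%:R * D%:R / q%:R.

Let sig0 : 0 <= sig.
Proof.
exact: (divr_ge0 (mulr_ge0 (mulr_ge0 (ler0n _ _) (ler0n _ _)) (ler0n _ _)) (ler0n _ _)).
Qed.

Lemma flow_final_slope y z : z \in nbrs y -> `|u N z - u N y| <= sig.
Proof.
have M1 : 1 <= M%:R :> R by rewrite ler1n.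
have qq : 0 < q%:R :> R by rewrite ltr0n.
have QE : Q = q%:R ^+ 2 by rewrite /Q natrX.
have g1 v : Gamma (u N) (u N) v <= 8 * D%:R * M%:R / Q.
  have err : N%:R * (D%:R * h ^+ 2 + N%:R * h * (4 * D%:R ^+ 3 * h ^+ 2)) <= 1.
    have D2 : D%:R != 0 :> R by rewrite pnatr_eq0 -lt0n.
    have -> : N%:R * (D%:R * h ^+ 2 + N%:R * h * (4 * D%:R ^+ 3 * h ^+ 2)) =
      (N%:R * h) * (w + (N%:R * h) * (4 * D%:R ^+ 3 * h)) by rewrite /w; ring.
    rewrite Nh; have -> : Q / (4 * D%:R) * (4 * D%:R ^+ 3 * h) = Q * D%:R * w.
      by rewrite /w; field; rewrite D2.
    have -> : Q / (4 * D%:R) * (w + Q * D%:R * w) = (w * Q) * (4 * D%:R)^-1 + 4^-1 * (w * Q ^+ 2).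
      by field; rewrite D2.
    have : (4 * D%:R)^-1 <= 1 :> R by rewrite invf_le1; move: D1; lra.
    have : w * Q ^+ 2 <= eps ^+ 2.
      apply: le_trans hsmall; rewrite -/w ler_wpM2l //; have := Q1; nra.
    have : 0 <= w * Q by rewrite mulr_ge0 //; move: Q1; lra.
    have := wQ; have := eps2; nra.
  have := flow_gradient degD cd (ltW h0) hD E8 u0E NE v err u0_le0.
  have := flow_ge degD (ltW h0) hD N v u0_ge; rewrite -/u Nh => lo hi.
  rewrite ler_pdivlMr; last by move: Q1; lra.
  have D4 : 0 < 4 * D%:R :> R by move: D1; lra.
  have : Q * Gamma (u N) (u N) v <= (2 * M%:R) * (4 * D%:R).
    rewrite -ler_pdivrMr // mulrAC; apply: le_trans hi _; lra.
  lra.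
move=> zy; apply: (slope_of_Gamma degD g1 sig0 _ zy).
rewrite /sig expr_div_n -QE mulrA ler_pM2r ?invr_gt0; last by move: Q1; lra.
have -> : M%:R = (128 * p%:R) ^+ 2 * D%:R :> R by rewrite /M /height natrM natrX natrM.
by rewrite le_eqVlt; apply/orP; left; apply/eqP; ring.
Qed.

Lemma flow_lower y : y \in cball (2 * r).-1 x -> - (M%:R / 4) <= u N y.
Proof.
move=> yx; have qq : 0 < q%:R :> R by rewrite ltr0n.
apply: le_trans (cball_slope (s := sig) flow_final_slope sig0 yx).
have : (2 * r).-1%:R * sig <= (2 * r)%:R * sig by rewrite ler_wpM2r // ler_nat leq_pred.
have : (2 * r)%:R * sig <= M%:R / 8.
  have t0 : 0 <= 512 * p%:R * D%:R :> R.
    exact: (mulr_ge0 (mulr_ge0 (ler0n _ _) (ler0n _ _)) (ler0n _ _)).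
  rewrite /sig mulrA ler_pdivrMr //.
  have -> : M%:R / 8 * q%:R = (4 * p%:R * q%:R) * (512 * p%:R * D%:R) :> R.
    by rewrite /M /height natrM natrX natrM; field.
  move: (512 * p%:R * D%:R) t0 => t t0; apply: ler_wpM2r => //.
  rewrite -!natrM ler_nat -mulnA.
  by move: rpq; clear; lia.
by have := flow_center; move: (u N x) (_ * sig) (_ * sig) => a b c; lra.
Qed.

Let f0 y : R := (y \in cball r.-1 x)%:R.

(** The flow is at least - M / 4 on the ball of radius 2r, and exp (- M / 4) is
    much larger than exp (- M), so the lower bound must come from the heat of the
    small ball. *)
Lemma heat_lower y : y \in cball (2 * r).-1 x ->
  expR (- M%:R) <= iter N (heat_step h) f0 y.
Proof.
move=> yx; have M1 : 16 <= M%:R :> R.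
  rewrite ler_nat /M /height; have : (0 < p ^ 2 * D)%N by rewrite muln_gt0 expn_gt0 p0.
  by rewrite expnMn -mulnA; clear; lia.
pose s := 2 * D%:R * eps.
have s0 : 0 <= s by rewrite !mulr_ge0 // ltW.
have Es : 2 * E <= s ^+ 2.
  have -> : 2 * E = 4 * eps ^+ 2 * D%:R by rewrite /E; ring.
  have -> : s ^+ 2 = 4 * eps ^+ 2 * (D%:R * D%:R) by rewrite /s; ring.
  by rewrite ler_wpM2l ?mulr_ge0 ?sqr_ge0 // ler_peMr.
have u0f z : expR (u0 z) <= f0 z + expR (- M%:R).
  rewrite /f0; have [zr|zr] := boolP (z \in cball r.-1 x).
    by rewrite -[leLHS]addr0 lerD ?expR_ge0 // -expR0 ler_expR.
  rewrite add0r ler_expR /u0 /cutoff.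
  have -> : layer r x z = r by rewrite -(prednK r0); exact: layer_out.
  by rewrite /eps divfK // gt_eqF.
have f00 z : 0 <= f0 z by rewrite ler0n.
have := exp_flow_le degD (ltW h0) hD cd E8 Es s0 u0E NE y (leqnn N)
  (expR_ge0 _) f00 u0f.
rewrite -/u; set F := iter N _ _ _ => up.
have F0 : 0 <= F by exact: (heat_ge0 degD (ltW h0) hD).
have lo := flow_lower yx.
have rate0 : 0 <= cubic_rate D h s.
  by rewrite /cubic_rate !(mulr_ge0, addr_ge0, exprn_ge0) // ltW.
have ratio : (1 + h * cubic_rate D h s) ^+ N <= expR 1.
  apply: (@le_trans _ _ (expR (N%:R * (h * cubic_rate D h s)))).
    have hr0 : 0 <= 1 + h * cubic_rate D h s by apply: addr_ge0 => //;
      apply: mulr_ge0 => //; exact: ltW.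
    by rewrite expRM_natl lerXn2r ?nnegrE ?expR_ge0 ?expR_ge1Dx.
  rewrite ler_expR mulrA Nh /cubic_rate.
  have D2 : D%:R != 0 :> R by rewrite pnatr_eq0 -lt0n.
  have -> : Q / (4 * D%:R) * (4 * (D%:R * s ^+ 3 + 2 * h * D%:R ^+ 2)) =
    8 * (D%:R ^+ 3 * (eps ^+ 3 * Q)) + 2 * (w * Q).
    by rewrite /s /w; field; rewrite D2.
  have : D%:R ^+ 3 * (eps ^+ 3 * Q) <= 16^-1.
    apply: (@le_trans _ _ (D%:R ^+ 3 * (eps ^+ 3 * r%:R ^+ 2))).
      rewrite ler_wpM2l ?exprn_ge0 // ler_wpM2l ?exprn_ge0 ?(ltW eps0) //.
      by rewrite /Q natrX ler_pXn2r ?nnegrE // ler_nat.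
    have -> : D%:R ^+ 3 * (eps ^+ 3 * r%:R ^+ 2) = (D%:R * M%:R) ^+ 3 / r%:R.
      by rewrite /eps; field; rewrite gt_eqF.
    rewrite ler_pdivrMr //.
    have : ((16 * (D * M) ^ 3)%N)%:R <= r%:R :> R by rewrite ler_nat.
    rewrite natrM natrX natrM; lra.
  have := wQ; have := eps2; lra.
have up2 : expR (u N y) <= expR 1 * (F + expR (- M%:R)).
  by apply: le_trans up _; rewrite ler_wpM2r // addr_ge0 // expR_ge0.
have lo2 : expR (- (M%:R / 4)) <= expR (u N y) by rewrite ler_expR.
(* As M >= 16, one has 1 + 1 - M <= - M / 4; one factor e is the ratio above,
   the other one pays for the factor 2. *)
have key : expR 1 * (2 * expR (- M%:R)) <= expR (- (M%:R / 4)) :> R.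
  apply: (@le_trans _ _ (expR (1 : R) * (expR 1 * expR (- M%:R)))).
    rewrite ler_wpM2l ?expR_ge0 // ler_wpM2r ?expR_ge0 //.
    by have := expR_ge1Dx (1 : R); lra.
  by rewrite -!expRD ler_expR; lra.
have : expR 1 * (2 * expR (- M%:R)) <= expR 1 * (F + expR (- M%:R)).
  exact: le_trans key (le_trans lo2 up2).
by rewrite ler_pM2l ?expR_gt0 //; lra.
Qed.

(** Sum [heat_lower] over the large ball: the heat semigroup preserves the total
    mass, which is the cardinality of the small ball. *)
Lemma doubling_at_scale : expR (- M%:R) * (size (undup (cball (2 * r).-1 x)))%:R <=
  (size (undup (cball r.-1 x)))%:R :> R.
Proof.
set S := undup (cball (2 * r).-1 x).
apply: (@le_trans _ _ (\sum_(y <- S) iter N (heat_step h) f0 y)).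
  rewrite mulr_natr -(count_predT S) -iter_addr_0 -big_const_seq.
  rewrite big_seq [leRHS]big_seq; apply: ler_sum => y yS.
  by apply: heat_lower; rewrite mem_undup in yS.
apply: (sum_heat degD (ltW h0) hD); first exact: undup_uniq.
  by move=> y; rewrite ler0n.
move=> T uT; rewrite /f0 -natr_sum ler_nat.
have -> : (\sum_(y <- T)
  (y \in cball r.-1 x) = size [seq y <- T | y \in cball r.-1 x])%N.
  by rewrite size_filter -sum1_count [RHS]big_mkcond; apply: eq_bigr => y _;
    case: (_ \in _).
apply: uniq_leq_size; first by rewrite filter_uniq.
by move=> y; rewrite mem_filter mem_undup => /andP[].
Qed.

End Doubling.

(** * Balls as finite sets and the theorem *)

Section Balls.
Variables (R : realType) (G : sgraph).
Implicit Types x y : G.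

Lemma degree_bound_of_sup (d : nat) :
  ereal_sup [set deg R x | x in [set: G]] = d%:R%:E -> degree_bound G d.+1.
Proof.
move=> sup_d; split=> // x.
have : (deg R x <= d%:R%:E)%E by rewrite -sup_d; apply: ereal_sup_ubound; exists x.
rewrite /deg /counting; case: asboolP => // fx; rewrite lee_fin ler_nat => xd.
by split=> //; exact: leqW.
Qed.

Variable D : nat.
Hypothesis degD : degree_bound G D.

Lemma path_cball x p : path (@adj G) x p -> last x p \in cball (size p) x.
Proof.
elim/last_ind: p => [_|p y IH]; first by rewrite inE.
rewrite rcons_path last_rcons size_rcons => /andP[/IH lp ly].
by apply: cballS lp _; right; rewrite (mem_nbrs degD).
Qed.

Lemma cball_walk n x y : y \in cball n x ->
  exists2 p, walks x y p & (size p <= n)%N.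
Proof.
elim: n y => [|n IH] y; first by rewrite inE => /eqP ->; exists [::].
move=> /cballSP[w /IH[p [xp wp] pn] [->|]]; first by exists p => //; exact: leqW.
rewrite (mem_nbrs degD) => wy; exists (rcons p y); last by rewrite size_rcons.
by split; rewrite ?last_rcons // rcons_path xp wp.
Qed.

Lemma gballE x r : gball R x r.+1 = [set` cball r x].
Proof.
apply/seteqP; split=> y /=; rewrite /gball /gdist /=.
  move=> /ereal_inf_lt[_ [p [xp <-] <-]]; rewrite lte_fin ltr_nat ltnS => pr.
  exact: cball_mono pr _ (path_cball xp).
move=> /cball_walk[p xyp pr].
apply: (@le_lt_trans _ _ (size p)%:R%:E); last by rewrite lte_fin ltr_nat ltnS.
by apply: ereal_inf_lbound; exists p.
Qed.

Lemma counting_gball x r :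
  counting (gball R x r.+1) = (size (undup (cball r x)))%:R%:E :> \bar R.
Proof.
rewrite gballE /counting asboolT; last exact: finite_seq.
congr (_%:R%:E); apply: perm_size; apply: uniq_perm.
- exact: finmap.fset_uniq.
- exact: undup_uniq.
by move=> y; rewrite in_fset_set ?mem_undup; [apply/idP/idP;
  rewrite inE|exact: finite_seq].
Qed.

End Balls.

Theorem theorem1p1 (R : realType) (d : nat) :
  exists K : R, forall G : sgraph,
    connected_graph G ->
    ereal_sup [set deg R x | x in [set: G]] = d%:R%:E ->
    CD0oo R G ->
    forall (x : G) (r : nat), (1 <= r)%N ->
      (counting (gball R x (2 * r)%N) <= K%:E * counting (gball R x r))%E.
Proof.
pose D := d.+1; pose p := Num.bound (8 * loss_const R D).
pose r0 := large_radius D p; pose M := height D p.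
exists (expR M%:R + (D.+1 ^ (2 * r0))%:R) => G _ sup_d cd x r r1.
have degD := degree_bound_of_sup sup_d.
have [k kE] : exists k, (2 * r = k.+1)%N by exists (2 * r).-1;
  rewrite prednK // muln_gt0.
have [l lE] : exists l, (r = l.+1)%N by exists r.-1; rewrite prednK.
have -> : gball R x (2 * r) = gball R x k.+1 by rewrite kE.
have -> : gball R x r = gball R x l.+1 by rewrite lE.
rewrite !(counting_gball R degD) -EFinM lee_fin.
have l1 : 1 <= (size (undup (cball l x)))%:R :> R.
  by rewrite ler1n lt0n size_eq0; apply/eqP => /(congr1 (mem^~ x)) /=;
    rewrite mem_undup cball_center.
have e0 : 0 < expR M%:R :> R by exact: expR_gt0.
have [rr|rr] := leqP r0 r; last first.
  (* For small radii the large ball has a bounded number of vertices, and the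
     small one contains x. *)
  have aux (a b s t : R) : 0 < a -> 0 <= b -> t <= b -> 1 <= s -> t <= (a + b) * s
    by nra.
  apply: aux => //.
  rewrite ler_nat; apply: leq_trans (size_undup _) _.
  apply: leq_trans (size_cball degD k x) _; rewrite leq_exp2l //.
  by move: kE rr; clear; lia.
have loss0 : 0 <= 8 * loss_const R D.
  have tau0 : 0 < time_unit R D by rewrite invr_gt0 mulr_gt0 // ltr0n.
  have := gain_const_gt0 degD tau0 => g0.
  apply: mulr_ge0 => //; apply: addr_ge0; first exact: mulr_ge0.
  by apply: addr_ge0; [rewrite divr_ge0 // ltW|exact: mulr_ge0].
have hp : 8 * loss_const R D <= p%:R by apply: ltW; exact: archi_boundP.
pose q := (r %/ p)%N; pose eps : R := M%:R / r%:R; pose Q : R := (q ^ 2)%:R.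
have M0 : 0 < M%:R :> R.
  have p0 : (0 < p)%N by rewrite /p /Num.bound.
  by rewrite ltr0n /M /height muln_gt0 expn_gt0 muln_gt0 p0.
have eps0 : 0 < eps by rewrite divr_gt0 // ltr0n.
pose J := (Num.bound (time_unit R D * D%:R * (Q + 9) ^+ 2 / eps ^+ 2)).
have J0 : (0 < J)%N by rewrite /J /Num.bound.
have tau0 : 0 <= time_unit R D by rewrite invr_ge0 mulr_ge0.
have hs : time_unit R D / J%:R * D%:R * (Q + 9) ^+ 2 <= eps ^+ 2.
  have J1 : 0 < J%:R :> R by rewrite ltr0n.
  have -> : time_unit R D / J%:R * D%:R * (Q + 9) ^+ 2 =
    time_unit R D * D%:R * (Q + 9) ^+ 2 / J%:R by field; rewrite gt_eqF.
  rewrite ler_pdivrMr // [leRHS]mulrC -ler_pdivrMr ?exprn_gt0 //.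
  apply: ltW; apply: archi_boundP; rewrite divr_ge0 ?sqr_ge0 //.
  by rewrite mulr_ge0 ?sqr_ge0 // mulr_ge0.
have := doubling_at_scale degD cd x hp rr J0 hs.
have -> : (2 * r).-1 = k by rewrite kE.
have -> : r.-1 = l by rewrite lE.
rewrite -/M expRN ler_pdivrMl // => main; apply: le_trans main _.
by rewrite ler_wpM2r // lerDl.
Qed.
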